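(* Let $q$ be an odd prime power and let $B\subset\mathbb{P}^2$ be the Ballico-Hefez curve over $\mathbb{F}_q$, i.e. the image of $\Phi:\mathbb{P}^1\to\mathbb{P}^2$, $\Phi(s,t)=(s^{q+1},\,s^{q}t+st^{q},\,t^{q+1})$. Then: (i) $C_L(B(\mathbb{F}_q),\mathcal{O}(1))$ is a $\left[\frac{q^2+q+2}{2},\,3,\,\frac{q^2-1}{2}\right]_q$-code, and it achieves the Griesmer bound. (ii) For $q\ge 5$, $C_L(B(\mathbb{F}_q),\mathcal{O}(2))$ is a $\left[\frac{q^2+q+2}{2},\,6,\,\frac{q^2-q-4}{2}\right]_q$-code. (iii) For $q\ge 7$, $C_L(B(\mathbb{F}_q),\mathcal{O}(3))$ is a $\left[\frac{q^2+q+2}{2},\,10,\,\frac{q^2-2q-7}{2}\right]_q$-code.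
   Context: $B(\mathbb{F}_q)$ is the set of points of $B$ in $\mathbb{P}^2(\mathbb{F}_q)$. For a subset $S\subset\mathbb{P}^2(\mathbb{F}_q)$ with $s$ elements, fix for each $P\in S$ a representative $(a_0,a_1,a_2)\in\mathbb{F}_q^3$ of its homogeneous coordinates, so that $F(P)\in\mathbb{F}_q$ is defined for every homogeneous polynomial $F(X_0,X_1,X_2)$ over $\mathbb{F}_q$. Let $\Gamma(\mathcal{O}(i))$ be the $\mathbb{F}_q$-vector space of homogeneous polynomials of degree $i$ in $X_0,X_1,X_2$ over $\mathbb{F}_q$ (including $0$). The linear code $C_L(S,\mathcal{O}(i))\subset\mathbb{F}_q^s$ is the image of the $\mathbb{F}_q$-linear map $\Gamma(\mathcal{O}(i))\to\mathbb{F}_q^{s}$, $F\mapsto(F(P))_{P\in S}$. An $[n,k,d]_q$-code is an $\mathbb{F}_q$-linear code of length $n$, dimension $k$ and minimum distance (exactly) $d$. Such a code achieves the Griesmer bound if $n=\sum_{i=0}^{k-1}\lceil d/q^i\rceil$. *)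

(* Defs.v *)
From HB Require Import structures.
From mathcomp Require Import all_boot all_order all_algebra.
From mathcomp Require Import boolp.
From mathcomp.multinomials Require Import mpoly.

Set Implicit Arguments.
Unset Strict Implicit.
Unset Printing Implicit Defensive.

Import GRing.Theory.
Local Open Scope ring_scope.

(* A point of P^2(F) is the set of all its homogeneous coordinate vectors. *)
Definition proj_point (F : finFieldType) (v : 'rV[F]_3) : {set 'rV[F]_3} :=
  [set c *: v | c : F & c != 0].

Definition proj_plane (F : finFieldType) : {set {set 'rV[F]_3}} :=
  [set proj_point v | v : 'rV[F]_3 & v != 0].

Definition BH_map (q : nat) (L : fieldType) (s t : L) : 'rV[L]_3 :=
  \row_j [:: s ^+ q.+1; s ^+ q * t + s * t ^+ q; t ^+ q.+1]`_j.

Definition on_BH (q : nat) (L : fieldType) (w : 'rV[L]_3) : Prop :=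
  exists s t c : L, [/\ (s, t) != (0, 0), c != 0 & w = c *: BH_map q s t].

(* B is the image of P^1 as a variety, so its F-points are the points of
   P^2(F) lying on the image of P^1(L) for an algebraically closed L containing
   F; the image of P^1(F) alone is in general strictly smaller. *)
Definition BH_points (F : finFieldType) (L : closedFieldType)
    (iota : {rmorphism F -> L}) : {set {set 'rV[F]_3}} :=
  [set P in proj_plane F |
    `[< exists2 v, v \in P & on_BH #|F| (map_mx iota v) >]].

Section EvaluationCode.
Variables (F : finFieldType) (S : {set {set 'rV[F]_3}}).
Variable rep : {set 'rV[F]_3} -> 'rV[F]_3.

(* [dhomog 3 F i] is the space of homogeneous polynomials of degree [i] in
   three variables, [0] included; [enum_val] lists the points of [S]. *)
Definition eval_points (i : nat) (p : dhomog 3 F i) : 'rV[F]_#|S| :=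
  \row_(j < #|S|) (mpoly_of_dhomog p).@[fun k => rep (enum_val j) 0 k].

Lemma eval_points_is_linear i : linear (@eval_points i).
Proof.
move=> a u v; apply/rowP => j; rewrite !mxE.
rewrite (linearP (@mpoly_of_dhomog 3 F i)); exact: linearP.
Qed.

HB.instance Definition _ i := GRing.isLinear.Build F (dhomog 3 F i)
  'rV[F]_#|S| _ (@eval_points i) (@eval_points_is_linear i).

Definition code_L (i : nat) : {vspace 'rV[F]_#|S|} :=
  limg (linfun (@eval_points i)).

End EvaluationCode.

Definition hamming_dist (F : finFieldType) (N : nat) (x y : 'rV[F]_N) : nat :=
  #|[set j | x 0 j != y 0 j]|.

Definition min_distance_is (F : finFieldType) (N : nat)
    (C : {vspace 'rV[F]_N}) (d : nat) : Prop :=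
  (exists x y, [/\ x \in C, y \in C, x != y & hamming_dist x y = d]) /\
  (forall x y, x \in C -> y \in C -> x != y -> (d <= hamming_dist x y)%N).

Definition is_code (F : finFieldType) (N : nat) (C : {vspace 'rV[F]_N})
    (n k d : nat) : Prop :=
  [/\ N = n, \dim C = k & min_distance_is C d].

Definition achieves_griesmer (q n k d : nat) : Prop :=
  n%:Z = \sum_(i < k) Num.ceil (d%:Q / q%:Q ^+ i).

(* Main.v *)
Require Import Defs.
From mathcomp Require Import all_boot all_order all_algebra.
From mathcomp Require Import all_solvable all_field boolp ring zify.
From mathcomp.multinomials Require Import mpoly.

(** Why the theorem holds.  Write q for the order of F, q odd.  A point (1 : a : b) is on the image
of P^1 when X^2 - a X + b has its two roots u and u^q; Frobenius then permutes these roots, so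
the rational points of B are exactly the v with disc v = v1^2 - 4 v0 v2 equal to zero or to a
nonsquare of F ([BH_point_inBH]): a conic together with its internal points.  Their number is
q (q + 1) / 2 + 1 ([card_BH]).

The minimum distances reduce to one bound: a form of degree d <= 3 that is not identically zero
vanishes at no more than d (q + 3) / 2 points of B ([BH_nzeros_form]).
- A rational line carries at most (q + 3) / 2 points of B ([BH_nzeros_line]), since restricted
  to it disc is, after completing the square, y^2 - e, and the hyperbola y^2 - w^2 = e has q - 1
  points.
- If the zero set of the form contains a rational line, a linear factor splits off
  ([form_line_factor]) and induction on d applies.
- If it contains none, all zeros in the whole plane are few enough ([nproj_zeros_line_free]).
  Lines through a rational point show that a conic, or a cubic singular at a rational point, has
  at most q + 2 of them.

The remaining case, a cubic with a smooth rational point P and no rational line, is where an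
argument finer than projection from P is needed, because that alone gives 2 q + 3 points.  The
bound (3 q + 9) / 2 comes from the method of Stohr and Voloch: count the points whose Frobenius
image lies on the tangent, all rational points being such, with multiplicity two.  Placing P at
(0 : 0 : 1) with tangent x = 0, the other points are the solutions of z^2 + g(y) z + k(y) = 0,
deg g <= 2, deg k <= 3.  Put D = g^2 - 4 k, w = 2 z + g, c = g_2 and u = X^q - X.  The condition
that Frobenius moves a point along its tangent reads E - 2 c w u^2 = 0 with
  E = 2 D (D^((q-1)/2) - 1) - D' u     ([tangent_poly]),
and its norm down to F[y] is E^2 - 4 c^2 D u^4 ([tangent_norm]).  This norm vanishes at y to order
at least twice the number of solutions z above y ([tangent_norm_vanishing]), has degree at most
3 q + 5 because its top terms cancel ([size_tangent_norm]), and is nonzero: for c = 0 because D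
has degree three ([tangent_poly_cubic_neq0]), for c <> 0 because otherwise D would be a square,
which puts a line on the cubic ([tangent_norm_eq0_square]).

The bound is attained by products of d secants through the external point (0 : 1 : 0), whose
zeros on B are disjoint ([BH_nzeros_secants]); there are (q - 1) / 2 such secants, which is at
least d exactly under the hypotheses made on q.  Since d (q + 3) / 2 is smaller than the number of
points of B, a polynomial with zero code word vanishes as a function, hence is zero as d < q
([mpoly_fun_eq0]); so the dimension is that of the space of forms. *)

Set Implicit Arguments.
Unset Strict Implicit.
Unset Printing Implicit Defensive.

Import Order.TTheory GRing.Theory Num.Theory.
Local Open Scope ring_scope.

(** * Counting pairs fibrewise *)

Lemma card_pair_fibers (A B : finType) (P : A -> B -> bool) :
  #|[set ab | P ab.1 ab.2]| = (\sum_a #|[set b | P a b]|)%N.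
Proof.
rewrite -sum1_card (eq_bigr (fun a => \sum_(b in [set b | P a b]) 1)%N).
  by rewrite pair_big_dep /=; apply: eq_bigl => -[a b]; rewrite !inE.
by move=> a _; rewrite sum1_card.
Qed.

(** The shape taken by a count of points on a line that is the graph of a function. *)
Lemma card_graph_fibers (A B : finType) (P : A -> B -> bool) (g : A -> B) :
  (\sum_a #|[set b | P a b && (b == g a)]|)%N = #|[set a | P a (g a)]|.
Proof.
rewrite -(card_pair_fibers (fun a b => P a b && (b == g a))).
rewrite -(card_imset [set a | P a (g a)] (f := fun a => (a, g a))); last by move=> a a' [].
apply: eq_card => -[a b]; rewrite inE /=; apply/andP/imsetP => [[Pab /eqP bE]|[a']].
  by exists a; rewrite ?inE -?bE.
by rewrite inE => Pa [-> ->].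
Qed.

(** * Vanishing orders of polynomials over a finite field *)

Section Poly.
Variable F : finFieldType.
Implicit Types (p f g k : {poly F}) (e : F -> nat).

Lemma pnat_pchar_card : [pchar F].-nat #|F|.
Proof.
have [p p_pr pcharFp] := finPcharP F.
rewrite (eq_pnat _ (pcharf_eq pcharFp)) -cardsT.
by have := abelem_pgroup (fin_ring_pchar_abelem pcharFp).
Qed.

Lemma natr_card : #|F|%:R = 0 :> F.
Proof.
have [p p_pr pcharFp] := finPcharP F.
apply/eqP; rewrite -(dvdn_pcharf pcharFp).
have := pnat_pchar_card; rewrite (eq_pnat _ (pcharf_eq pcharFp)).
case/p_natP=> [[|n] card_F]; last by rewrite card_F expnS dvdn_mulr.
by have := finNzRing_gt1 F; rewrite card_F.
Qed.

Lemma odd_card_two_neq0 : odd #|F| -> 2 != 0 :> F.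
Proof.
move=> odd_q; apply: contraTneq (oner_neq0 F) => F2_0.
have := natr_card; rewrite -(odd_double_half #|F|) odd_q natrD -muln2 natrM F2_0.
by rewrite mulr0 addr0 negbK => /eqP.
Qed.

Lemma dvdp_prod_XsubC_exp e p :
  (forall y, ('X - y%:P) ^+ e y %| p) -> \prod_y ('X - y%:P) ^+ e y %| p.
Proof.
move=> dvd_p; have := index_enum_uniq F.
elim: (index_enum F) => [|y s IHs] /=; first by rewrite big_nil dvd1p.
case/andP=> y_notin_s /IHs dvd_s; rewrite big_cons Gauss_dvdp ?dvd_p //.
rewrite coprimep_expl // coprimep_sym coprimep_XsubC.
apply/negP => /rootP; rewrite horner_prod => /eqP; rewrite prodf_seq_eq0.
case/hasP=> x x_in_s; rewrite horner_exp hornerXsubC expf_eq0 subr_eq0 /=.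
by case/andP=> _ /eqP y_eq_x; rewrite y_eq_x x_in_s in y_notin_s.
Qed.

(** The form in which degrees bound numbers of points: distinct linear factors are coprime, so
vanishing orders at distinct points add up. *)
Lemma sum_vanishing_order_lt e p :
  p != 0 -> (forall y, ('X - y%:P) ^+ e y %| p) -> (\sum_y e y < size p)%N.
Proof.
move=> p_neq0 /dvdp_prod_XsubC_exp /(dvdp_leq p_neq0); apply: leq_trans.
rewrite size_prod; last by move=> y _; rewrite expf_neq0 // polyXsubC_eq0.
rewrite [X in (_ < X.+1 - _)%N](eq_bigr (fun y => e y + 1)%N).
  by rewrite big_split /= sum1_card -addSn addnK.
by move=> y _; rewrite size_exp_XsubC addn1.
Qed.

Lemma double_root_dvdp p y : p.[y] = 0 -> p^`().[y] = 0 -> ('X - y%:P) ^+ 2 %| p.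
Proof.
move=> /rootP; rewrite -dvdp_XsubCl => /dvdpP [r ->].
rewrite derivM derivXsubC mulr1 hornerD hornerM hornerXsubC subrr mulr0 add0r.
by move/rootP; rewrite -dvdp_XsubCl => r_y; rewrite expr2 dvdp_mul.
Qed.

Lemma size_polyM_leqS p g a b : (size p <= a.+1)%N -> (size g <= b.+1)%N ->
  (size (p * g)%R <= (a + b).+1)%N.
Proof.
move=> sp sg; apply: leq_trans (size_polyMleq _ _) _.
by apply: (@leq_trans (a.+1 + b.+1).-1); [lia | rewrite addnS].
Qed.

Lemma size_poly_exp_leqS p a n : (size p <= a.+1)%N -> (size (p ^+ n)%R <= (n * a).+1)%N.
Proof.
move=> sp; elim: n => [|n IHn]; first by rewrite expr0 size_poly1.
by rewrite exprS mulSn size_polyM_leqS.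
Qed.

Lemma size_polyD_leq p g a : (size p <= a)%N -> (size g <= a)%N -> (size (p + g)%R <= a)%N.
Proof. by move=> sp sg; apply: leq_trans (size_polyD _ _) _; rewrite geq_max sp. Qed.

End Poly.

(** * Affine points of z^2 + g(y) z + k(y) = 0 *)

Section Tangent.
Variable F : finFieldType.
Local Notation q := #|F|.
Hypothesis odd_q : odd q.
Local Notation m := q./2.
Local Notation u := ('X^q - 'X : {poly F}).
Implicit Types D : {poly F}.

(** On the curve w^2 = D, the equation 2 w dw - D' dy of the tangent at (y, w), applied to the
displacement (y^q - y, w^q - w); w^(q+1) is a power of D, so w drops out. *)
Definition tangent_poly D : {poly F} := 2%:P * D * (D ^+ m - 1) - D^`() * u.

Lemma card_eq_half : q = m.*2.+1. Proof. by rewrite -[LHS]odd_double_half odd_q. Qed.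

Lemma frobenius_poly_root (y : F) : u.[y] = 0.
Proof. by rewrite !hornerE expf_card subrr. Qed.

Lemma deriv_frobenius_poly : u^`() = -1.
Proof.
by rewrite derivB derivXn derivX -mulr_natr -polyC_natr natr_card mulr0 sub0r.
Qed.

Lemma tangent_poly_root D y : D.[y] = 0 -> 'X - y%:P %| tangent_poly D.
Proof.
move=> Dy; rewrite dvdp_XsubCl; apply/rootP; rewrite /tangent_poly.
move: (frobenius_poly_root y); move: ('X^q - 'X) => v vy.
by rewrite hornerD hornerN !hornerM vy Dy; ring.
Qed.

(** Above y there is a rational point (y, w); Frobenius fixes it, so the tangency condition holds
there, and it holds to second order since the derivative of Frobenius is zero. *)
Lemma tangent_poly_double_root D y w :
  D.[y] = w ^+ 2 -> w != 0 -> ('X - y%:P) ^+ 2 %| tangent_poly D.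
Proof.
move=> Dy w0.
have Dm : D.[y] ^+ m = 1.
  rewrite Dy -exprM mul2n; apply: (mulfI w0).
  by rewrite -exprS -card_eq_half mulr1 expf_card.
have m2 : m%:R * 2 = -1 :> F.
  by apply/eqP; rewrite -subr_eq0 opprK -natrM muln2 natr1 -card_eq_half natr_card.
have Dm1 : D.[y] * D.[y] ^+ m.-1 = 1.
  rewrite -exprS prednK // lt0n; apply/eqP => m0.
  by have := finNzRing_gt1 F; rewrite card_eq_half m0.
rewrite /tangent_poly; move: (frobenius_poly_root y) deriv_frobenius_poly.
move: ('X^q - 'X) => v vy dv.
apply: double_root_dvdp.
  by rewrite hornerD hornerN !hornerM vy !hornerE Dm; ring.
rewrite derivB !derivM derivB derivC deriv_exp dv !derivC.
rewrite !(hornerD, hornerN, hornerM, hornerMn, horner_exp, hornerC) vy Dm.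
rewrite -[_ *+ m]mulr_natr.
transitivity (D^`().[y] * (1 + m%:R * 2 * (D.[y] * D.[y] ^+ m.-1))).
  by ring.
by rewrite Dm1 m2 mulr1 subrr mulr0.
Qed.
End Tangent.

Section TangentNorm.
Variable F : finFieldType.
Local Notation q := #|F|.
Hypothesis odd_q : odd q.
Local Notation m := q./2.
Implicit Types g k D : {poly F}.

(** With w^2 = D, the product of E - 2 c w u^2 and its conjugate E + 2 c w u^2.  The extra term
appears on passing from w to z = (w - g) / 2: for g = c X^2 + ... of degree at most
two, g^q - g - g' u = c u^2. *)
Definition tangent_norm (c : F) D : {poly F} :=
  tangent_poly D ^+ 2 - (4%:R * c ^+ 2)%:P * D * ('X^q - 'X) ^+ 4.

Lemma poly_frobeniusD (p r : {poly F}) : (p + r) ^+ q = p ^+ q + r ^+ q.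
Proof.
by rewrite exprDn_pchar // (eq_pnat _ (@pchar_poly F)) pnat_pchar_card.
Qed.

Lemma size_poly_sub_lead (p : {poly F}) n :
  (size p <= n.+1)%N -> (size (p - (p`_n)%R *: 'X^n)%R <= n)%N.
Proof.
move=> size_p; apply/leq_sizeP => j; rewrite leq_eqVlt coefB coefZ coefXn.
case/predU1P=> [<-|n_lt_j]; first by rewrite eqxx mulr1 subrr.
by rewrite gtn_eqF // mulr0 subr0 nth_default // (leq_trans size_p).
Qed.

(** In E^2 the term of highest degree is 4 D^(q+1) = 4 D D^q, and D^q has leading part
c^2 X^(4q), which is also the leading part of c^2 u^4.  After this cancellation all that is left
has degree at most 3 q + 5. *)
Lemma size_tangent_norm c D :
  (size (D - (c ^+ 2)%:P * 'X^4)%R <= 4)%N -> (size (tangent_norm c D) <= 3 * q + 6)%N.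
Proof.
set r := D - _ => size_r.
have size_D : (size D <= 5)%N.
  have -> : D = r + (c ^+ 2)%:P * 'X^4 by rewrite subrK.
  apply: size_polyD_leq; first exact: leq_trans size_r _.
  by apply: (@size_polyM_leqS _ _ _ 0 4); rewrite ?size_polyC_leq1 ?size_polyXn.
have size_C (a : F) : (size a%:P <= 1)%N by exact: size_polyC_leq1.
have q_gt1 := finNzRing_gt1 F.
have size_u : (size ('X^q - 'X : {poly F})%R <= q.+1)%N.
  by rewrite size_polyD_leq ?size_polyXn // size_polyN size_polyX ltnS ltnW.
have size_D' : (size D^`()%R <= 4)%N.
  by apply: leq_trans (size_poly _ _) _; rewrite -subn1 leq_subLR.
have Dq : D ^+ q = (c ^+ 2)%:P * ('X^q) ^+ 4 + r ^+ q.
  rewrite -[D](subrK ((c ^+ 2)%:P * 'X^4)) -/r poly_frobeniusD addrC exprMn -polyC_exp.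
  by rewrite expf_card -!exprM mulnC.
pose R := - (2%:P * D) - D^`() * ('X^q - 'X).
have -> : tangent_norm c D =
    4%:P * D * (r ^+ q + (c ^+ 2)%:P * (('X^q) ^+ 4 - ('X^q - 'X) ^+ 4))
    + 4%:P * D ^+ m.+1 * R + R ^+ 2.
  have -> : r ^+ q = D * (D ^+ m) ^+ 2 - (c ^+ 2)%:P * ('X^q) ^+ 4.
    by rewrite -exprM muln2 -exprS -card_eq_half // Dq addrC addKr.
  rewrite /tangent_norm /tangent_poly /R (exprS D) !(polyCM, polyC_exp, polyC_natr).
  by move: ('X^q) (D ^+ m) D^`() => v w d; ring.
have size_R : (size R <= (q + 3).+1)%N.
  rewrite size_polyD_leq // size_polyN.
    by apply: leq_trans (@size_polyM_leqS _ _ _ 0 4 _ _) _ => //; lia.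
  by apply: leq_trans (@size_polyM_leqS _ _ _ 3 q _ _) _ => //; lia.
have size_Xq : (size ('X^q : {poly F}) <= q.+1)%N by rewrite size_polyXn.
have size_u4 :
    (size (('X^q) ^+ 4 - ('X^q - 'X : {poly F}) ^+ 4)%R <= (3 * q + 1).+1)%N.
  have -> : ('X^q) ^+ 4 - ('X^q - 'X : {poly F}) ^+ 4 =
      'X * (4%:P * 'X^q ^+ 3 + (- 6)%:P * ('X^q ^+ 2 * 'X)
            + 4%:P * ('X^q * 'X ^+ 2) + (- 1)%:P * 'X ^+ 3).
    by rewrite !(polyCN, polyC_natr); move: ('X^q) => v; ring.
  have size_monom i j (a : F) : (i + j <= 3)%N ->
      (size (a%:P * ('X^q ^+ i * 'X ^+ j))%R <= (3 * q).+1)%N.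
    move=> le_ij3; have size_Xj := size_poly_exp_leqS j (eq_leq (size_polyX F)).
    have := size_polyM_leqS (size_poly_exp_leqS i size_Xq) size_Xj.
    move=> /(size_polyM_leqS (size_C a)) /leq_trans; apply; rewrite add0n ltnS; nia.
  apply: leq_trans (@size_polyM_leqS _ _ _ 1 (3 * q) _ _) _; rewrite ?size_polyX //; last lia.
  do 3?apply: size_polyD_leq.
  - by have := size_monom 3 0 4 isT; rewrite expr0 mulr1.
  - exact: size_monom 2 1 _ isT.
  - exact: size_monom 1 2 _ isT.
  - by have := size_monom 0 3 (- 1) isT; rewrite expr0 mul1r.
have size_4D : (size (4%:P * D)%R <= 5)%N by exact: (@size_polyM_leqS _ _ _ 0 4).
do 2?apply: size_polyD_leq.
- apply: leq_trans (@size_polyM_leqS _ _ _ 4 (3 * q + 1) _ _) _ => //; last lia.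
  apply: size_polyD_leq; last exact: (@size_polyM_leqS _ _ _ 0).
  apply: leq_trans (size_poly_exp_leqS q size_r) _; lia.
- have size_Dm := size_poly_exp_leqS m.+1 size_D.
  apply: leq_trans (size_polyM_leqS (size_polyM_leqS (size_C 4) size_Dm) size_R) _.
  by have := card_eq_half odd_q; lia.
- by apply: leq_trans (size_poly_exp_leqS 2 size_R) _; lia.
Qed.
End TangentNorm.

Section CoverPoints.
Variable F : finFieldType.
Local Notation q := #|F|.
Hypothesis odd_q : odd q.
Local Notation m := q./2.
Implicit Types g k D : {poly F}.

(** When the norm is zero, D times a nonzero square is a square. *)
Lemma tangent_norm_eq0_square c D :
  c != 0 -> tangent_norm c D = 0 -> exists h, D = h ^+ 2.
Proof.
move=> c_neq0 /eqP; rewrite subr_eq0 => /eqP E2.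
pose v : {poly F} := (2 * c)%:P * ('X^q - 'X) ^+ 2.
(* the norm is E^2 - D v^2 *)
have v2E : (4%:R * c ^+ 2)%:P * D * ('X^q - 'X) ^+ 4 = D * v ^+ 2.
  by rewrite /v !(polyCM, polyC_exp, polyC_natr); move: ('X^q) => w; ring.
have v_neq0 : v != 0.
  rewrite mulf_neq0 ?expf_neq0 ?polyC_eq0 ?mulf_neq0 ?odd_card_two_neq0 //.
  by rewrite -size_poly_gt0 size_polyDl ?size_polyXn // size_polyN size_polyX ltnS finNzRing_gt1.
have /dvdpP [h Eh] : v %| tangent_poly D.
  by rewrite -(@dvdp_pexp2r _ _ _ 2) // E2 v2E dvdp_mull.
exists h; apply: (mulIf (expf_neq0 2 v_neq0)).
by rewrite -v2E -E2 Eh exprMn.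
Qed.

(** Degrees suffice: for a cubic, D^((q+1)/2) has degree 3 (q + 1) / 2, which exceeds q + 2. *)
Lemma tangent_poly_cubic_neq0 D : size D = 4 -> tangent_poly D != 0.
Proof.
move=> size_D; pose R := - (2%:P * D) - D^`() * ('X^q - 'X).
have q_gt1 := finNzRing_gt1 F; have q_half := card_eq_half odd_q.
have D_neq0 : D != 0 by rewrite -size_poly_gt0 size_D.
have two_neq0 := odd_card_two_neq0 odd_q.
have size_lead : size (2%:P * D ^+ m.+1) = (3 * m.+1).+1.
  rewrite size_Cmul // -[LHS]prednK ?size_exp ?size_D //.
  by rewrite size_poly_gt0 expf_neq0.
have size_R : (size R <= (q + 2).+1)%N.
  rewrite size_polyD_leq // size_polyN.
    apply: leq_trans (@size_polyM_leqS _ _ _ 0 3 _ _) _; last by lia.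
      by rewrite size_polyC_leq1.
    by rewrite size_D.
  apply: leq_trans (@size_polyM_leqS _ _ _ 2 q _ _) _; last lia.
    by apply: leq_trans (size_poly _ _) _; rewrite size_D.
  by rewrite size_polyD_leq ?size_polyXn // size_polyN size_polyX ltnS ltnW.
have -> : tangent_poly D = 2%:P * D ^+ m.+1 + R.
  by rewrite /tangent_poly /R (exprS D); move: ('X^q) (D ^+ m) D^`() => v w d; ring.
rewrite -size_poly_gt0 size_polyDl ?size_lead // (leq_ltn_trans size_R) //.
by move: q_gt1 q_half; rewrite -!addnn; move: #|F| m => Q M; lia.
Qed.

(** Two solutions z above y mean that D(y) is a nonzero square, where E^2 and u^4 vanish to order
four; one solution means D(y) = 0, where order two is available. *)
Lemma tangent_norm_vanishing c g k y :
  ('X - y%:P) ^+ (2 * #|[set z | z ^+ 2 + g.[y] * z + k.[y] == 0]|)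
    %| tangent_norm c (g ^+ 2 - 4%:P * k).
Proof.
set D := _ ^+ 2 - _; set Z := [set z | _].
case: (set_0Vmem Z) => [-> | [z]]; first by rewrite cards0 dvd1p.
rewrite inE => /eqP z_root.
have Dy : D.[y] = (2 * z + g.[y]) ^+ 2.
  rewrite /D hornerD hornerN horner_exp hornerM hornerC.
  have -> : k.[y] = - (z ^+ 2 + g.[y] * z) by apply/eqP; rewrite -addr_eq0 addrC z_root.
  by ring.
have Z_sub : Z \subset [set z; - g.[y] - z].
  apply/subsetP=> z'; rewrite !inE => /eqP z'_root.
  rewrite -subr_eq0 -[z' == - _ - _]subr_eq0 -mulf_eq0.
  by rewrite -(subrr 0) -{1}z'_root -z_root; apply/eqP; ring.
have dvd_u : 'X - y%:P %| 'X^q - 'X by rewrite dvdp_XsubCl; apply/rootP/frobenius_poly_root.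
rewrite /tangent_norm; have [Dw0|Dw_neq0] := eqVneq (2 * z + g.[y]) 0.
  have Z_le1 : (#|Z| <= 1)%N.
    apply: leq_trans (subset_leq_card Z_sub) _; rewrite cards2.
    case: eqP => //= neq; case: neq; apply/eqP.
    by rewrite -subr_eq0 -Dw0; apply/eqP; ring.
  apply: (@dvdp_trans _ (('X - y%:P) ^+ 2)); first by rewrite dvdp_exp2l //; lia.
  rewrite dvdp_sub ?dvdp_exp2r ?tangent_poly_root ?Dy ?Dw0 ?expr0n //.
  by apply/dvdp_mull/(dvdp_trans _ (dvdp_exp2r 4 dvd_u)); rewrite dvdp_exp2l.
have Z_le2 : (#|Z| <= 2)%N.
  by apply: leq_trans (subset_leq_card Z_sub) _; rewrite cards2; case: eqP.
apply: (@dvdp_trans _ (('X - y%:P) ^+ 4)); first by rewrite dvdp_exp2l //; lia.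
rewrite dvdp_sub //; last by rewrite dvdp_mull // dvdp_exp2r.
rewrite (exprM _ 2 2); apply: dvdp_exp2r.
exact: tangent_poly_double_root Dw_neq0.
Qed.

(** The points not at infinity of a cubic with a smooth rational point.  The hypothesis on the top
coefficients excludes the line x = 0 from the cubic and the last one excludes the lines
z = l(y). *)
Lemma card_monic_quadratic_cover g k :
  (size g <= 3)%N -> (size k <= 4)%N -> (g`_2 != 0) || (k`_3 != 0) ->
  (forall l : {poly F}, (size l <= 2)%N -> l ^+ 2 + g * l + k != 0) ->
  (2 * #|[set yz : F * F | yz.2 ^+ 2 + g.[yz.1] * yz.2 + k.[yz.1] == 0 :> F]%R|
     <= 3 * q + 5)%N.
Proof.
move=> size_g size_k top_neq0 no_line.
have two_neq0 := odd_card_two_neq0 odd_q.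
pose c := g`_2; pose g1 := g - c *: 'X^2; pose D := g ^+ 2 - 4%:P * k.
have size_g1 : (size g1 <= 2)%N by exact: size_poly_sub_lead.
have gE : g = c *: 'X^2 + g1 by rewrite /g1 addrC subrK.
have size_D : (size (D - (c ^+ 2)%:P * 'X^4)%R <= 4)%N.
  have -> : D - (c ^+ 2)%:P * 'X^4 = g1 * ((2 * c)%:P * 'X^2 + g1) - 4%:P * k.
    by rewrite /D gE -mul_polyC !(polyCM, polyC_exp, polyC_natr); ring.
  rewrite size_polyD_leq // ?size_polyN.
    apply: (@size_polyM_leqS _ _ _ 1 2) => //; apply: size_polyD_leq.
      by apply: (@size_polyM_leqS _ _ _ 0 2); rewrite ?size_polyC_leq1 ?size_polyXn.
    exact: leq_trans size_g1 _.
  by apply: (@size_polyM_leqS _ _ _ 0 3); rewrite ?size_polyC_leq1.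
suff N_neq0 : tangent_norm c D != 0.
  have := sum_vanishing_order_lt N_neq0 (tangent_norm_vanishing c g k).
  move=> /leq_trans /(_ (size_tangent_norm odd_q size_D)).
  rewrite -big_distrr /= addnS ltnS; congr (2 * _ <= _)%N.
  by rewrite (card_pair_fibers (fun y z => z ^+ 2 + g.[y] * z + k.[y] == 0)).
have [c_eq0|c_neq0] := eqVneq c 0.
  rewrite /tangent_norm c_eq0 expr0n mulr0 polyC0 !mul0r subr0 expf_neq0 //.
  apply: tangent_poly_cubic_neq0; apply/eqP; rewrite eqn_leq; apply/andP; split.
    by rewrite c_eq0 expr0n polyC0 mul0r subr0 in size_D.
  rewrite -/c c_eq0 eqxx in top_neq0.
  rewrite ltnNge; apply: contraNN top_neq0 => /leq_sizeP /(_ 3 isT) /eqP.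
  rewrite coefB gE c_eq0 scale0r add0r coefCM nth_default ?sub0r.
    by rewrite oppr_eq0 mulf_eq0 -[4%:R]/((2 * 2)%:R) natrM mulf_eq0 (negPf two_neq0).
  by apply: leq_trans (size_poly_exp_leqS 2 size_g1) _.
apply/eqP => /(tangent_norm_eq0_square c_neq0) [h0 Dh0].
(* of the two square roots of D, the one with the same leading coefficient as g, so that
   (h - g) / 2 is linear *)
have [h [Dh h2 size_h]] : exists h, [/\ D = h ^+ 2, h`_2 = c & (size h <= 3)%N].
  have size_lead : size ((c ^+ 2)%:P * 'X^4) = 5.
    by rewrite size_Cmul ?expf_neq0 // size_polyXn.
  have DE : D = (c ^+ 2)%:P * 'X^4 + (D - (c ^+ 2)%:P * 'X^4) by rewrite addrC subrK.
  have lead_D : lead_coef D = c ^+ 2.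
    by rewrite DE lead_coefDl ?size_lead // lead_coefM lead_coefC lead_coefXn mulr1.
  have size_D5 : size D = 5 by rewrite DE size_polyDl ?size_lead.
  have size_h0 : size h0 = 3.
    have := size_exp h0 2; rewrite -Dh0 size_D5; move: (size h0) => n; lia.
  have lead_h0 : h0`_2 = lead_coef h0 by rewrite lead_coefE size_h0.
  have := lead_coef_exp h0 2; rewrite -Dh0 lead_D -lead_h0 => /eqP.
  rewrite eq_sym eqf_sqr; case/pred2P => h0_2.
    by exists h0; rewrite ?size_h0.
  by exists (- h0); rewrite ?sqrrN ?size_polyN ?size_h0 ?coefN ?h0_2 ?opprK.
have two2 : (2^-1)%:P * 2 = 1 :> {poly F}.
  by rewrite -(polyC_natr F 2) -polyCM mulVf.
have size_l : (size ((2^-1)%:P * (h - g))%R <= 2)%N.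
  have size_hg : (size (h - g)%R <= 3)%N by rewrite size_polyD_leq ?size_polyN.
  have := size_poly_sub_lead size_hg.
  rewrite coefB h2 subrr scale0r subr0 => ?.
  by apply: (@size_polyM_leqS _ _ _ 0 1); rewrite ?size_polyC_leq1.
case/negP: (no_line _ size_l).
have : (2^-1)%:P ^+ 2 * (h ^+ 2 - D) = 0 :> {poly F} by rewrite Dh subrr mulr0.
rewrite /D !polyC_natr => <-; move: (2^-1)%:P two2 => i i2.
apply/eqP; transitivity ((i * (h - g)) ^+ 2 + (i * 2) * g * (i * (h - g)) + (i * 2) ^+ 2 * k).
  by rewrite i2 mul1r expr1n mul1r.
by ring.
Qed.
End CoverPoints.

(** * Counting projective points by normalised vectors *)

Lemma ord3P (P : 'I_3 -> Prop) : P 0 -> P 1 -> P 2%:R -> forall i, P i.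
Proof.
move=> P0 P1 P2 [[|[|[|i]]] lt_i3] //.
- by congr P: P0; apply: val_inj.
- by congr P: P1; apply: val_inj.
- by congr P: P2; apply: val_inj.
Qed.

Lemma sum3E (V : nmodType) (f : 'I_3 -> V) : \sum_i f i = f 0 + f 1 + f 2%:R.
Proof.
rewrite !big_ord_recr big_ord0 /= add0r.
by congr (f _ + f _ + f _); apply: val_inj.
Qed.

Section Points.
Variable F : finFieldType.
Local Notation q := #|F|.
Local Notation V := 'rV[F]_3.
Implicit Types (u v : V) (Phi Psi : pred V).

Definition vec3 (x y z : F) : V := \row_j [:: x; y; z]`_j.
Arguments vec3 (x y z)%_R.

Lemma vec3_0 x y z : vec3 x y z 0 0 = x. Proof. by rewrite mxE. Qed.
Lemma vec3_1 x y z : vec3 x y z 0 1 = y. Proof. by rewrite mxE. Qed.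
Lemma vec3_2 x y z : vec3 x y z 0 2%:R = z. Proof. by rewrite mxE. Qed.
Definition vec3E := (vec3_0, vec3_1, vec3_2).

Lemma vec3_eta v : v = vec3 (v 0 0) (v 0 1) (v 0 2%:R).
Proof. by apply/rowP; apply: ord3P; rewrite vec3E. Qed.

Lemma scale_vec3 c x y z : c *: vec3 x y z = vec3 (c * x) (c * y) (c * z).
Proof. by apply/rowP; apply: ord3P; rewrite [LHS]mxE !vec3E. Qed.

Lemma vec3_inj x y z x' y' z' : vec3 x y z = vec3 x' y' z' -> [/\ x = x', y = y' & z = z'].
Proof.
by move=> /rowP eq_v; have := (eq_v 0, eq_v 1, eq_v 2%:R); rewrite !vec3E => -[[]].
Qed.

(** A nonzero vector has exactly one multiple whose first nonzero coordinate is 1. *)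
Definition leading v : F :=
  if v 0 0 != 0 then v 0 0 else if v 0 1 != 0 then v 0 1 else v 0 2%:R.

Lemma leadingZ c v : leading (c *: v) = c * leading v.
Proof.
rewrite /leading !mxE; have [->|c0] := eqVneq c 0; first by rewrite !mul0r eqxx.
rewrite !mulf_eq0 (negPf c0) /=.
by case: ifP => // _; case: ifP.
Qed.

Lemma leading_eq0 v : (leading v == 0) = (v == 0).
Proof.
apply/idP/eqP => [|->]; last by rewrite /leading !mxE !eqxx.
rewrite /leading; have [v0|/negPf->//] := eqVneq (v 0 0) 0; rewrite /=.
have [v1|/negPf->//] := eqVneq (v 0 1) 0; rewrite /= => /eqP v2.
by rewrite [v]vec3_eta v0 v1 v2; apply/rowP; apply: ord3P; rewrite vec3E mxE.
Qed.

(** Each point of the projective plane has one representative with leading coordinate 1, so this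
is a number of projective points as soon as [Phi] is [scale_invariant]. *)
Definition nproj Phi : nat := #|[set v | (leading v == 1) && Phi v]|.

Definition scale_invariant Phi := forall c v, c != 0 -> Phi (c *: v) = Phi v.

Lemma leading1_neq0 v : leading v == 1 -> v != 0.
Proof. by move=> /eqP v1; rewrite -leading_eq0 v1 oner_eq0. Qed.

(** Relates [nproj] to a count free of any choice of coordinates; this gives invariance under linear
substitutions. *)
Lemma card_cone Phi : scale_invariant Phi ->
  #|[set v | (v != 0) && Phi v]| = (q.-1 * nproj Phi)%N.
Proof.
move=> PhiZ; pose units := [set c : F | c != 0].
have -> : q.-1 = #|units|.
  by have := cardsC1 (0 : F); move=> <-; apply: eq_card => c; rewrite !inE.
rewrite /nproj -cardsX -(card_in_imset (f := fun cv => cv.1 *: cv.2)).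
  apply: eq_card => v; apply/idP/imsetP => [|[[c w]]].
    rewrite inE => /andP[v0 Phiv]; have lv0 : leading v != 0 by rewrite leading_eq0.
    exists (leading v, (leading v)^-1 *: v) => /=; last by rewrite scalerA divff ?scale1r.
    by rewrite !inE lv0 leadingZ mulVf // eqxx PhiZ ?invr_eq0.
  rewrite !inE /= => /and3P[c0 /leading1_neq0 w0 Phiw] ->.
  by rewrite scaler_eq0 negb_or c0 w0 PhiZ.
move=> [c v] [c' v']; rewrite !inE /= => /and3P[c0 /eqP v1 _] /and3P[c'0 /eqP v'1 _] eq_cv.
have eq_c : c = c' by rewrite -[c]mulr1 -v1 -leadingZ eq_cv leadingZ v'1 mulr1.
by rewrite eq_c in eq_cv *; rewrite (scalerI c'0 eq_cv).
Qed.

Lemma eq_nproj Phi Psi : (forall v, v != 0 -> Phi v = Psi v) -> nproj Phi = nproj Psi.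
Proof.
move=> eq_Phi; apply: eq_card => v; rewrite !inE.
by case lv1: (_ == 1) => //=; rewrite eq_Phi ?leading1_neq0.
Qed.

Lemma nproj_leq Phi Psi : (forall v, v != 0 -> Phi v -> Psi v) -> (nproj Phi <= nproj Psi)%N.
Proof.
move=> sub; apply/subset_leq_card/subsetP => v; rewrite !inE => /andP[v1 Phiv].
by rewrite v1 sub ?leading1_neq0.
Qed.

Lemma nprojU Phi Psi : (nproj (fun v => Phi v || Psi v) <= nproj Phi + nproj Psi)%N.
Proof.
apply: leq_trans (leq_card_setU _ _); apply/subset_leq_card/subsetP => v.
by rewrite !inE; case: (_ == 1).
Qed.

Lemma nprojU_disjoint Phi Psi :
  (forall v, v != 0 -> ~~ (Phi v && Psi v)) ->
  nproj (fun v => Phi v || Psi v) = (nproj Phi + nproj Psi)%N.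
Proof.
move=> disj; rewrite /nproj -cardsUI [X in (_ + X)%N](_ : _ = 0%N) ?addn0; last first.
  apply: eq_card0 => v; rewrite !inE; apply/negP=> /andP[/andP[v1 Phiv] /andP[_ Psiv]].
  by have := disj v (leading1_neq0 v1); rewrite Phiv Psiv.
by apply: eq_card => v; rewrite !inE -andb_orr.
Qed.

Lemma nproj_mulmx Phi (M : 'M[F]_3) : M \in unitmx -> scale_invariant Phi ->
  nproj (fun v => Phi (v *m M)) = nproj Phi.
Proof.
move=> uM PhiZ; apply/eqP; rewrite -(@eqn_pmul2l q.-1); last first.
  by have := finNzRing_gt1 F; case: #|F| => [|[]].
rewrite -!card_cone //; last by move=> c v c0; rewrite -scalemxAl PhiZ.
apply/eqP; rewrite -(card_imset _ (can_inj (mulmxK uM))).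
apply: eq_card => v; apply/imsetP/idP => [[w]|].
  rewrite !inE => /andP[w0 Phiw] ->; rewrite Phiw andbT.
  by apply: contraNneq w0 => wM0; rewrite -(mulmxK uM w) wM0 mul0mx.
rewrite inE => /andP[v0 Phiv]; exists (v *m invmx M); last by rewrite mulmxKV.
rewrite inE mulmxKV // Phiv andbT.
by apply: contraNneq v0 => vM0; rewrite -(mulmxKV uM v) vM0 mul0mx.
Qed.

(** The plane as an affine plane, an affine line and a point. *)
Lemma nproj_affine Phi :
  nproj Phi = (#|[set ab | Phi (vec3 1 ab.1 ab.2)]|
               + #|[set b | Phi (vec3 0 1 b)]| + Phi (vec3 0 0 1))%N.
Proof.
rewrite /nproj.
rewrite -(card_imset [set ab | Phi (vec3 1 ab.1 ab.2)]
  (f := fun ab => vec3 1 ab.1 ab.2)); last first.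
  by move=> [a b] [a' b'] /vec3_inj /= [_ -> ->].
rewrite -(card_imset [set b | Phi (vec3 0 1 b)] (f := fun b => vec3 0 1 b)); last first.
  by move=> b b' /vec3_inj [_ _ ->].
have -> : (Phi (vec3 0 0 1) : nat) = #|[set v in [set vec3 0 0 1] | Phi v]|.
  have [Phi1|nPhi1] := boolP (Phi (vec3 0 0 1)).
    apply/esym/eqP/cards1P; exists (vec3 0 0 1); apply/setP=> v; rewrite !inE.
    by case: (v =P _) => //= ->; rewrite Phi1.
  symmetry; apply: eq_card0 => v; rewrite !inE.
  by case: (v =P _) => //= ->; apply/negbTE.
set A := _ @: _; set B := _ @: _; set C := [set v in _ | _].
have disj_AB : A :&: B = set0.
  apply/setP=> v; rewrite !inE; apply/andP=> -[/imsetP[ab _ ->] /imsetP[b _ /vec3_inj [/eqP]]].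
  by rewrite oner_eq0.
have disj_ABC : (A :|: B) :&: C = set0.
  apply/setP=> v; rewrite !inE; apply/negbTE/negP=> /and3P[vAB /eqP v_eq _].
  move: vAB; rewrite v_eq.
  by case/orP => /imsetP [? _ /vec3_inj [/esym/eqP + /esym/eqP]]; rewrite oner_eq0.
rewrite -(cardsUI A B) disj_AB cards0 addn0 -(cardsUI _ C) disj_ABC cards0 addn0.
apply: eq_card => v; rewrite !inE; apply/andP/orP.
  rewrite [v]vec3_eta /leading !vec3E; move: (v 0 0) (v 0 1) (v 0 2%:R) => x y z.
  have [->|x0] := eqVneq x 0 => /=; first (have [->|y0] := eqVneq y 0 => /=);
    case=> /eqP eq1 Phiv; rewrite eq1 in Phiv *.
  - by right; rewrite eqxx Phiv.
  - by left; apply/orP; right; apply/imsetP; exists z; rewrite ?inE.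
  - by left; apply/orP; left; apply/imsetP; exists (y, z); rewrite ?inE.
case=> [|/andP[/eqP-> ->]]; last by rewrite /leading !vec3E !eqxx.
move=> /orP[] /imsetP[b]; rewrite inE => Phib ->; rewrite Phib /leading !vec3E ?oner_eq0 //=.
by rewrite !eqxx.
Qed.

Lemma card_proj_points (Psi : pred {set V}) Phi :
  (forall v, v != 0 -> Psi (proj_point v) = Phi v) ->
  #|[set P in proj_plane F | Psi P]| = nproj Phi.
Proof.
move=> PsiE; rewrite /nproj -(card_in_imset (f := @proj_point F)).
  apply: eq_card => P; rewrite inE; apply/andP/imsetP => [[/imsetP[v v0 ->]]|[v]].
    have {}v0 : v != 0 by rewrite inE in v0.
    rewrite PsiE // => Phiv.
    have lv0 : leading v != 0 by rewrite leading_eq0.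
    have eq_pt : proj_point v = proj_point ((leading v)^-1 *: v).
      apply/setP=> w; apply/imsetP/imsetP => -[c c0 ->].
        exists (c * leading v); first by rewrite inE in c0; rewrite inE mulf_neq0.
        by rewrite scalerA mulfK.
      exists (c / leading v); first by rewrite inE in c0; rewrite inE mulf_neq0 ?invr_eq0.
      by rewrite scalerA.
    exists ((leading v)^-1 *: v) => //; rewrite inE leadingZ mulVf // eqxx.
    by rewrite -PsiE -?eq_pt ?PsiE // scaler_eq0 invr_eq0 negb_or lv0.
  rewrite inE => /andP[/leading1_neq0 v0 Phiv] ->; split; last by rewrite PsiE.
  by apply/imsetP; exists v; rewrite ?inE.
move=> v v'; rewrite !inE => /andP[/eqP v1 _] /andP[/eqP v'1 _] eq_pt.
have : v \in proj_point v'.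
  by rewrite -eq_pt; apply/imsetP; exists 1; rewrite ?inE ?oner_eq0 ?scale1r.
case/imsetP=> c _ vE; have := leadingZ c v'; rewrite -vE v1 v'1 mulr1 => c1.
by rewrite vE -c1 scale1r.
Qed.
End Points.
Arguments vec3 {F} (x y z)%_R.

(** * Ternary forms as functions, and lines contained in their zero sets *)

Section Forms.
Variable F : finFieldType.
Local Notation q := #|F|.
Local Notation V := 'rV[F]_3.
Implicit Types (f g h : V -> F) (u v : V) (a : 'cV[F]_3).

(** A form of degree [d] is treated as a function.  The recursion makes stability under linear
substitution and the splitting off of a coordinate immediate inductions, and a function that
vanishes on a line has a linear factor whatever the degree, which for polynomials needs d <= q. *)
Fixpoint is_form (d : nat) (f : V -> F) : Prop :=
  if d is e.+1 then
    exists g : 'I_3 -> V -> F,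
      (forall i, is_form e (g i)) /\ (forall v, f v = \sum_i v 0 i * g i v)
  else exists c, forall v, f v = c.

Lemma eq_form d f g : (forall v, f v = g v) -> is_form d f -> is_form d g.
Proof.
case: d => [|d] eq_fg; first by case=> c fE; exists c => v; rewrite -eq_fg.
by case=> h [hform fE]; exists h; split=> // v; rewrite -eq_fg.
Qed.

Lemma form_add d f g : is_form d f -> is_form d g -> is_form d (fun v => f v + g v).
Proof.
elim: d f g => [|d IHd] f g.
  by case=> [c fE] [c' gE]; exists (c + c') => v; rewrite fE gE.
case=> [h [hform fE]] [h' [formh' gE]]; exists (fun i v => h i v + h' i v).
split=> [i|v]; first exact: IHd (hform i) (formh' i).
by rewrite fE gE -big_split; apply: eq_bigr => i _; rewrite mulrDr.
Qed.

Lemma form_scale d c f : is_form d f -> is_form d (fun v => c * f v).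
Proof.
elim: d f => [|d IHd] f; first by case=> [c' fE]; exists (c * c') => v; rewrite fE.
case=> [h [hform fE]]; exists (fun i v => c * h i v).
split=> [i|v]; first exact: IHd (hform i).
by rewrite fE mulr_sumr; apply: eq_bigr => i _; rewrite mulrCA.
Qed.

Lemma form0 d : is_form d (fun=> 0).
Proof.
elim: d => [|d IHd]; first by exists 0.
by exists (fun=> fun=> 0); split=> // v; rewrite big1 // => i _; rewrite mulr0.
Qed.

Lemma form_sum d (I : Type) (s : seq I) (P : pred I) (f : I -> V -> F) :
  (forall i, P i -> is_form d (f i)) -> is_form d (fun v => \sum_(i <- s | P i) f i v).
Proof.
move=> formf; elim: s => [|i s IHs].
  by apply: eq_form (form0 d) => v; rewrite big_nil.
have [Pi|nPi] := boolP (P i).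
  by apply: eq_form (form_add (formf i Pi) IHs) => v; rewrite big_cons Pi.
by apply: eq_form IHs => v; rewrite big_cons (negPf nPi).
Qed.

Lemma form_coord d i f : is_form d f -> is_form d.+1 (fun v => v 0 i * f v).
Proof.
move=> formf; exists (fun j => if j == i then f else fun=> 0); split=> [j|v].
  by case: eqP => // _; apply: form0.
rewrite (bigD1 i) //= eqxx big1 ?addr0 // => j /negPf->; exact: mulr0.
Qed.

Lemma form_mulmx d f (M : 'M[F]_3) : is_form d f -> is_form d (fun v => f (v *m M)).
Proof.
elim: d f => [|d IHd] f; first by case=> c fE; exists c => v.
case=> g [formg fE]; apply: (@eq_form _ (fun v =>
   \sum_i \sum_j v 0 j * (M j i * g i (v *m M)))).
  move=> v; rewrite fE; apply: eq_bigr => i _.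
  by rewrite mxE mulr_suml; apply: eq_bigr => j _; rewrite mulrA.
apply: form_sum => i _; apply: form_sum => j _; apply: form_coord; apply: form_scale.
exact: IHd (formg i).
Qed.

Lemma form_homog d f c v : is_form d f -> f (c *: v) = c ^+ d * f v.
Proof.
elim: d f => [|d IHd] f; first by case=> c' fE; rewrite !fE mul1r.
case=> g [formg fE]; rewrite !fE mulr_sumr; apply: eq_bigr => i _.
by rewrite mxE (IHd _ (formg i)) exprS mulrACA.
Qed.

Lemma form_scale_invariant d f : is_form d f -> scale_invariant (fun v => f v == 0).
Proof.
move=> formf c v c0.
by rewrite (form_homog c v formf) mulf_eq0 expf_eq0 (negPf c0) andbF.
Qed.

(** The part of the form free of the first coordinate is its restriction to the line where that
coordinate is zero. *)
Lemma form_split_coord0 d f : is_form d.+1 f ->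
  exists2 f0, is_form d f0 &
    forall v, f v = v 0 0 * f0 v + f (vec3 0 (v 0 1) (v 0 2%:R)).
Proof.
elim: d f => [|d IHd] f [g [formg fE]].
  exists (g 0) => // v; rewrite !fE !sum3E !vec3E mul0r add0r addrA.
  have gC i u w : g i u = g i w by have [c gE] := formg i; rewrite !gE.
  by rewrite (gC 1 _ v) (gC 2%:R _ v).
have [h1 formh1 gE1] := IHd _ (formg 1).
have [h2 formh2 gE2] := IHd _ (formg 2%:R).
exists (fun v => g 0 v + (v 0 1 * h1 v + v 0 2%:R * h2 v)).
  by apply: form_add => //; apply: form_add; apply: form_coord.
move=> v; rewrite !fE !sum3E !vec3E (gE1 v) (gE2 v); ring.
Qed.

Definition vanishes_on_line f a := forall v, v *m a = 0 -> f v = 0.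
Definition contains_line f := exists2 a, a != 0 & vanishes_on_line f a.

Definition unit_col : 'cV[F]_3 := delta_mx 0 0.

Lemma mul_unit_col v : v *m unit_col = (v 0 0)%:M.
Proof.
apply/matrixP=> i j; rewrite !ord1 !mxE (bigD1 0) //= big1 => [|k /negPf k0].
  by rewrite mxE !eqxx mulr1 addr0.
by rewrite mxE k0 mulr0.
Qed.

(** Any line becomes the line where the first coordinate is zero in suitable coordinates. *)
Lemma exists_line_frame a : a != 0 -> exists2 M : 'M[F]_3, M \in unitmx & M *m a = unit_col.
Proof.
move=> a0; pose e : V := delta_mx 0 0.
have eT : e^T = unit_col by rewrite /e trmx_delta.
have eE : e *m (unit_col *m a^T) = a^T.
  by rewrite mulmxA mul_unit_col mxE eqxx mul1mx.
have [|M uM ME] := @complete_unitmx _ _ _ e (unit_col *m a^T).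
  rewrite eE !rank_rV trmx_eq0 a0; case: eqP => // /rowP/(_ 0)/eqP.
  by rewrite !mxE !eqxx oner_eq0.
exists (invmx M^T); first by rewrite unitmx_inv unitmx_tr.
have -> : a = M^T *m unit_col by rewrite -eT -trmx_mul -ME eE trmxK.
by rewrite mulKmx // unitmx_tr.
Qed.

Lemma exists_point_frame P : P != 0 -> exists2 M : 'M[F]_3, M \in unitmx & vec3 0 0 1 *m M = P.
Proof.
move=> P0; have e0 : vec3 0 0 1 != 0 :> V.
  by apply/eqP=> /rowP/(_ 2%:R)/eqP; rewrite vec3E mxE oner_eq0.
have eE : vec3 0 0 1 *m ((vec3 0 0 1)^T *m P) = P.
  rewrite mulmxA -[RHS]mul1mx; congr (_ *m _); apply/matrixP=> i j.
  by rewrite !ord1 mxE sum3E ![_^T _ _]mxE !vec3E !mulr0 !add0r mulr1 mxE.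
have [|M uM ME] := @complete_unitmx _ _ _ (vec3 0 0 1) ((vec3 0 0 1)^T *m P).
  by rewrite eE !rank_rV e0 P0.
by exists M; rewrite // -ME.
Qed.

(** In coordinates where the line is x = 0, the remainder in [form_split_coord0] is zero. *)
Lemma form_line_factor d f a : is_form d.+1 f -> a != 0 -> vanishes_on_line f a ->
  exists2 f0, is_form d f0 & forall v, f v = (v *m a) 0 0 * f0 v.
Proof.
move=> formf /exists_line_frame [M uM Ma] fa0.
have [f0 formf0 fE] := form_split_coord0 (form_mulmx M formf).
exists (fun v => f0 (v *m invmx M)); first exact: form_mulmx.
move=> v; rewrite -[in LHS](mulmxKV uM v) fE.
rewrite [f _]fa0 ?addr0; last first.
  by rewrite -mulmxA Ma mul_unit_col vec3E; apply/matrixP=> i j; rewrite !mxE mul0rn.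
by congr (_ * _); rewrite -(mulKmx uM a) Ma mulmxA mul_unit_col [RHS]mxE eqxx.
Qed.

Lemma contains_line_mulmx f (M : 'M[F]_3) :
  M \in unitmx -> contains_line (fun v => f (v *m M)) -> contains_line f.
Proof.
move=> uM [a a0 fMa]; exists (invmx M *m a).
  by apply: contraNneq a0 => Ma0; rewrite -(mulKVmx uM a) Ma0 mulmx0.
by move=> v va; rewrite -(mulmxKV uM v); apply: fMa; rewrite -mulmxA.
Qed.

Lemma form1E f : is_form 1 f ->
  exists k0 k1 k2, forall x y z, f (vec3 x y z) = k0 * x + k1 * y + k2 * z.
Proof.
case=> g [formg fE].
have [a aE] := formg 0; have [b bE] := formg 1; have [c cE] := formg 2%:R.
by exists a, b, c => x y z; rewrite fE sum3E aE bE cE !vec3E; ring.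
Qed.

Lemma form2E f : is_form 2 f -> exists k0 k1 k2 l0 l1 c, forall x y z,
  f (vec3 x y z) = (k0 * x ^+ 2 + k1 * x * y + k2 * y ^+ 2)
                   + (l0 * x + l1 * y) * z + c * z ^+ 2.
Proof.
case=> g [formg fE].
have [a0 [b0 [c0 E0]]] := form1E (formg 0).
have [a1 [b1 [c1 E1]]] := form1E (formg 1).
have [a2 [b2 [c2 E2]]] := form1E (formg 2%:R).
exists a0, (b0 + a1), b1, (c0 + a2), (c1 + b2), c2 => x y z.
by rewrite fE sum3E E0 E1 E2 !vec3E; ring.
Qed.

Lemma form3E f : is_form 3 f -> exists k0 k1 k2 k3 q0 q1 q2 l0 l1 c, forall x y z,
  f (vec3 x y z) = (k0 * x ^+ 3 + k1 * x ^+ 2 * y + k2 * x * y ^+ 2 + k3 * y ^+ 3)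
                   + (q0 * x ^+ 2 + q1 * x * y + q2 * y ^+ 2) * z
                   + (l0 * x + l1 * y) * z ^+ 2 + c * z ^+ 3.
Proof.
case=> g [formg fE].
have [a0 [b0 [c0 [l0 [m0 [n0 E0]]]]]] := form2E (formg 0).
have [a1 [b1 [c1 [l1 [m1 [n1 E1]]]]]] := form2E (formg 1).
have [a2 [b2 [c2 [l2 [m2 [n2 E2]]]]]] := form2E (formg 2%:R).
exists a0, (b0 + a1), (c0 + b1), c1, (l0 + a2), (m0 + l1 + b2), (m1 + c2).
exists (n0 + l2), (n1 + m2), n2 => x y z.
by rewrite fE sum3E E0 E1 E2 !vec3E; ring.
Qed.

End Forms.

(** * Plane curves of degree at most three containing no rational line *)

Section LineFree.
Variable F : finFieldType.
Local Notation q := #|F|.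
Local Notation V := 'rV[F]_3.
Implicit Types (f : V -> F) (v : V).

Lemma card_affine_zeros_le1 (r s : F) :
  (r != 0) || (s != 0) -> (#|[set z : F | (r * z + s)%R == 0%R]| <= 1)%N.
Proof.
move=> rs0; rewrite -(cards1 (- s / r)); apply/subset_leq_card/subsetP => z.
rewrite !inE => /eqP rzs; have [r0|r0] := eqVneq r 0.
  by move: rzs rs0; rewrite r0 mul0r add0r eqxx => ->; rewrite eqxx.
by rewrite -(inj_eq (mulfI r0)) mulrCA divff // mulr1 -subr_eq0 opprK rzs.
Qed.

Lemma vec3_mul_col x y z (k0 k1 k2 : F) :
  vec3 x y z *m (vec3 k0 k1 k2)^T = (x * k0 + y * k1 + z * k2)%:M.
Proof.
by apply/matrixP=> i j; rewrite !ord1 !mxE sum3E ![_^T _ _]mxE !vec3E.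
Qed.

Lemma vec3_neq0 (x y z : F) : [|| x != 0, y != 0 | z != 0] -> vec3 x y z != 0.
Proof.
apply: contraTneq => /rowP v0; have := (v0 0, v0 1, v0 2%:R).
by rewrite !vec3E !mxE => -[[-> ->] ->]; rewrite eqxx.
Qed.

Lemma scalar_mx1_eq0 (r : F) : (r%:M : 'M_1) = 0 -> r = 0.
Proof. by move/matrixP/(_ 0 0); rewrite !mxE eqxx. Qed.

Lemma contains_line_of_coef f (k0 k1 k2 : F) :
  [|| k0 != 0, k1 != 0 | k2 != 0] ->
  (forall x y z, x * k0 + y * k1 + z * k2 = 0 -> f (vec3 x y z) = 0) ->
  contains_line f.
Proof.
move=> /vec3_neq0 k_neq0 f0; exists (vec3 k0 k1 k2)^T; first by rewrite trmx_eq0.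
by move=> v; rewrite [v]vec3_eta vec3_mul_col => /scalar_mx1_eq0; apply: f0.
Qed.

(** Here the lines through (0 : 0 : 1) meet the curve in at most one further point, since a line
meeting it in two would lie on it. *)
Lemma nproj_zeros_singular d f : is_form d f ->
  (forall x y, exists r s : F, forall z, f (vec3 x y z) = r * z + s) ->
  ~ contains_line f -> f (vec3 0 0 1) = 0 ->
  (nproj (fun v => f v == 0%R) <= q + 2)%N.
Proof.
move=> formf f_affine no_line fP0.
have fP z : f (vec3 0 0 z) = 0.
  have := form_homog z (vec3 0 0 1) formf.
  by rewrite scale_vec3 !mulr0 mulr1 fP0 mulr0.
have fiber x y : (x != 0) || (y != 0) -> (#|[set z | f (vec3 x y z) == 0%R]| <= 1)%N.
  move=> xy0; have [r [s frs]] := f_affine x y.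
  have -> : [set z | f (vec3 x y z) == 0] = [set z | r * z + s == 0].
    by apply/setP=> z; rewrite !inE frs.
  apply: card_affine_zeros_le1; apply: contra_notT no_line.
  rewrite negb_or !negbK => /andP[/eqP r0 /eqP s0].
  apply: (@contains_line_of_coef _ y (- x) 0); first by rewrite oppr_eq0 eqxx orbF orbC.
  move=> x' y' z'; rewrite mulr0 addr0 mulrN => /eqP; rewrite subr_eq0 => /eqP collinear.
  (* a point of the line through (x, y, 0) and (0, 0, 1) *)
  have [t [-> ->]] : exists t, x' = t * x /\ y' = t * y.
    have [x0|x0] := eqVneq x 0.
      have y0 : y != 0 by rewrite x0 eqxx in xy0.
      exists (y' / y); rewrite divfK // x0 mulr0; split=> //.
      by apply: (mulIf y0); rewrite collinear x0 mulr0 mul0r.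
    by exists (x' / x); rewrite divfK // mulrAC collinear mulfK.
  have [->|t0] := eqVneq t 0; first by rewrite !mul0r fP.
  rewrite -[z'](divfK t0) [z' / t * t]mulrC -scale_vec3 (form_homog _ _ formf).
  by rewrite frs r0 s0 mul0r addr0 mulr0.
rewrite nproj_affine fP eqxx (card_pair_fibers (fun y z => f (vec3 1 y z) == 0)).
rewrite -[(_ + 2)%N]/(_ + (1 + 1))%N addnA leq_add2r leq_add ?fiber ?oner_eq0 ?orbT //.
by rewrite -sum1_card; apply: leq_sum => y _; rewrite fiber ?oner_eq0.
Qed.

(** A cubic smooth at (0 : 0 : 1) with tangent x = 0.  On x = 0 it has at most one other
point. *)
Lemma nproj_zeros_cubic_normal_form f (k0 k1 k2 k3 q0 q1 q2 : F) : odd q ->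
  (forall x y z, f (vec3 x y z) =
     (k0 * x ^+ 3 + k1 * x ^+ 2 * y + k2 * x * y ^+ 2 + k3 * y ^+ 3)
     + (q0 * x ^+ 2 + q1 * x * y + q2 * y ^+ 2) * z + x * z ^+ 2) ->
  ~ contains_line f -> (2 * nproj (fun v => f v == 0%R) <= 3 * q + 9)%N.
Proof.
move=> odd_q fE no_line.
pose g : {poly F} := q0%:P + q1 *: 'X + q2 *: 'X^2.
pose k : {poly F} := k0%:P + k1 *: 'X + k2 *: 'X^2 + k3 *: 'X^3.
have gy y : g.[y] = q0 + q1 * y + q2 * y ^+ 2 by rewrite /g !hornerE.
have ky y : k.[y] = k0 + k1 * y + k2 * y ^+ 2 + k3 * y ^+ 3 by rewrite /k !hornerE.
have size_monom n (r : F) m : (n < m)%N -> (size (r *: 'X^n)%R <= m)%N.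
  by move=> lt_nm; apply: leq_trans (size_scale_leq _ _) _; rewrite size_polyXn.
have size_g : (size g <= 3)%N.
  rewrite /g !size_polyD_leq ?size_monom //; first exact: leq_trans (size_polyC_leq1 _) _.
  exact: (size_monom 1).
have size_k : (size k <= 4)%N.
  rewrite /k !size_polyD_leq ?size_monom //; first exact: leq_trans (size_polyC_leq1 _) _.
  exact: (size_monom 1).
have g2 : g`_2 = q2 by rewrite /g !coefE /= !mulr0 !add0r mulr1.
have k3E : k`_3 = k3 by rewrite /k !coefE /= !mulr0 !add0r mulr1.
have top_neq0 : (q2 != 0) || (k3 != 0).
  apply: contra_notT no_line; rewrite negb_or !negbK => /andP[/eqP q20 /eqP k30].
  apply: (@contains_line_of_coef _ 1 0 0); first by rewrite oner_eq0.
  by move=> x y z; rewrite !mulr0 !addr0 mulr1 fE q20 k30 => ->; ring.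
have no_l (l : {poly F}) : (size l <= 2)%N -> l ^+ 2 + g * l + k != 0.
  move=> size_l; apply: contra_notN no_line => /eqP lk0.
  pose l0 := l`_0; pose l1 := l`_1.
  have lE : l = l0%:P + l1%:P * 'X.
    apply/polyP=> -[|[|i]]; rewrite coefD coefC coefMX ?coefC ?addr0 ?add0r //=.
    by rewrite nth_default // (leq_trans size_l).
  pose c0 := l0 ^+ 2 + q0 * l0 + k0.
  pose c1 := 2 * l0 * l1 + q0 * l1 + q1 * l0 + k1.
  pose c2 := l1 ^+ 2 + q1 * l1 + q2 * l0 + k2.
  pose c3 := q2 * l1 + k3.
  have cE : c0%:P + c1%:P * 'X + c2%:P * 'X^2 + c3%:P * 'X^3 = 0.
    rewrite -lk0 /g /k lE /c0 /c1 /c2 /c3 -!mul_polyC.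
    by rewrite !(polyCD, polyCM, polyC_exp, polyC_natr); ring.
  have c_eq0 i : (c0%:P + c1%:P * 'X + c2%:P * 'X^2 + c3%:P * 'X^3)`_i = 0.
    by rewrite cE coef0.
  have := (c_eq0 0, c_eq0 1, c_eq0 2, c_eq0 3)%N.
  rewrite !(coefD, coefCM, coefC, coefXn, coefX) /= !(mulr0, mulr1, addr0, add0r).
  case=> -[[c00 c10] c20] c30.
  apply: (@contains_line_of_coef _ l0 l1 (- 1)); first by rewrite oppr_eq0 oner_eq0 !orbT.
  move=> x y z /eqP; rewrite mulrN1 subr_eq0 => /eqP <-; rewrite fE.
  transitivity (c0 * x ^+ 3 + c1 * x ^+ 2 * y + c2 * x * y ^+ 2 + c3 * y ^+ 3).
    by rewrite /c0 /c1 /c2 /c3; ring.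
  by rewrite c00 c10 c20 c30; ring.
have := card_monic_quadratic_cover odd_q size_g size_k.
rewrite g2 k3E => /(_ top_neq0 no_l) bound.
rewrite nproj_affine fE.
have -> : #|[set ab : F * F | f (vec3 1 ab.1 ab.2) == 0%R]|
    = #|[set yz : F * F | (yz.2 ^+ 2 + g.[yz.1] * yz.2 + k.[yz.1])%R == 0%R]|.
  apply: eq_card => -[y z]; rewrite !inE /= fE gy ky; congr (_ == 0); ring.
have at_infinity : (#|[set b : F | f (vec3 0 1 b) == 0%R]| <= 1)%N.
  have -> : [set b : F | f (vec3 0 1 b) == 0] = [set z | q2 * z + k3 == 0].
    by apply/setP=> z; rewrite !inE fE; congr (_ == 0); ring.
  exact: card_affine_zeros_le1.
rewrite !mulnDr; apply: leq_trans
  (leq_add (leq_add bound (leq_mul (leqnn 2) at_infinity)) (leq_mul (leqnn 2) (leq_b1 _))) _.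
by lia.
Qed.

(** A rational point, if there is one, is moved to (0 : 0 : 1).  In degree three the coefficient
l0 x + l1 y of z^2 is the tangent at that point: it is zero in the singular case, and otherwise a
further substitution turns it into x. *)
Lemma nproj_zeros_line_free d f : odd q -> (d <= 3)%N -> is_form d f ->
  ~ contains_line f -> (2 * nproj (fun v => f v == 0%R) <= d * (q + 3))%N.
Proof.
move=> odd_q d_le3 formf no_line.
have [/existsP [P /andP[P0 /eqP fP]]|no_zero] :=
  boolP [exists v, (v != 0) && (f v == 0)]; last first.
  rewrite (_ : nproj _ = 0%N) ?muln0 //; apply: eq_card0 => v; rewrite !inE.
  apply/negP => /andP[/leading1_neq0 v0 fv]; case/negP: no_zero.
  by apply/existsP; exists v; rewrite v0.
have [M uM eM] := exists_point_frame P0.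
pose f1 v := f (v *m M).
have formf1 : is_form d f1 by exact: form_mulmx.
have no_line1 : ~ contains_line f1 by move/(contains_line_mulmx uM).
rewrite -(nproj_mulmx uM (form_scale_invariant formf)).
change (2 * nproj (fun v => f1 v == 0%R) <= d * (q + 3))%N.
have f1P : f1 (vec3 0 0 1) = 0 by rewrite /f1 eM.
clearbody f1; move: formf1 => {f formf no_line P P0 fP uM eM M} {}formf1.
case: d d_le3 formf1 => [|[|[|[|d]]]] // _ formf1.
- case: formf1 => c fE; case: no_line1; apply: (@contains_line_of_coef _ 1 0 0).
    by rewrite oner_eq0.
  by move=> x y z _; rewrite -f1P !fE.
- have [k0 [k1 [k2 fE]]] := form1E formf1.
  have k20 : k2 = 0 by rewrite -f1P fE; ring.
  case: no_line1; have [k00|k0_neq0] := eqVneq k0 0; last first.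
    apply: (@contains_line_of_coef _ k0 k1 k2); first by rewrite k0_neq0.
    by move=> x y z <-; rewrite fE; ring.
  have [k10|k1_neq0] := eqVneq k1 0; last first.
    apply: (@contains_line_of_coef _ k0 k1 k2); first by rewrite k1_neq0 orbT.
    by move=> x y z <-; rewrite fE; ring.
  apply: (@contains_line_of_coef _ 1 0 0); first by rewrite oner_eq0.
  by move=> x y z _; rewrite fE k00 k10 k20; ring.
- have [k0 [k1 [k2 [l0 [l1 [c fE]]]]]] := form2E formf1.
  have c0 : c = 0 by rewrite -f1P fE; ring.
  suff : (nproj (fun v => f1 v == 0%R) <= q + 2)%N by lia.
  apply: nproj_zeros_singular formf1 _ no_line1 f1P => x y.
  exists (l0 * x + l1 * y), (k0 * x ^+ 2 + k1 * x * y + k2 * y ^+ 2) => z.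
  by rewrite fE c0; ring.
have [k0 [k1 [k2 [k3 [q0 [q1 [q2 [l0 [l1 [c fE]]]]]]]]]] := form3E formf1.
have c0 : c = 0 by rewrite -f1P fE; ring.
have [/orP l_neq0|] := boolP ((l0 != 0) || (l1 != 0)); last first.
  rewrite negb_or !negbK => /andP[/eqP l00 /eqP l10].
  suff : (nproj (fun v => f1 v == 0%R) <= q + 2)%N by lia.
  apply: nproj_zeros_singular formf1 _ no_line1 f1P => x y.
  exists (q0 * x ^+ 2 + q1 * x * y + q2 * y ^+ 2),
    (k0 * x ^+ 3 + k1 * x ^+ 2 * y + k2 * x * y ^+ 2 + k3 * y ^+ 3) => z.
  by rewrite fE c0 l00 l10; ring.
have [r [s rs1]] : exists r s, r * l0 + s * l1 = 1.
  case: l_neq0 => l_neq0; first by exists l0^-1, 0; rewrite mulVf // mul0r addr0.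
  by exists 0, l1^-1; rewrite mulVf // mul0r add0r.
(* (x, y) |-> (r x - l1 y, s x + l0 y) has determinant r l0 + s l1 = 1 and takes the form
   l0 x + l1 y to x. *)
pose N : 'M[F]_3 := \matrix_(i, j)
  (vec3 (vec3 r s 0 0 j) (vec3 (- l1) l0 0 0 j) (vec3 0 0 1 0 j)) 0 i.
have mulN x y z : vec3 x y z *m N = vec3 (r * x - l1 * y) (s * x + l0 * y) z.
  apply/rowP; apply: ord3P; rewrite mxE sum3E !mxE /=; ring.
have uN : N \in unitmx.
  pose N' : 'M[F]_3 := \matrix_(i, j)
    (vec3 (vec3 l0 (- s) 0 0 j) (vec3 l1 r 0 0 j) (vec3 0 0 1 0 j)) 0 i.
  have mulN' x y z : vec3 x y z *m N' = vec3 (l0 * x + l1 * y) (- s * x + r * y) z.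
    by apply/rowP; apply: ord3P; rewrite mxE sum3E !mxE /=; ring.
  apply: (mulmx1_unit (B := N') _).1; apply/row_matrixP => i.
  rewrite !rowE mulmxA mulmx1 [delta_mx 0 i]vec3_eta mulN mulN'.
  have -> (x y : F) : l0 * (r * x - l1 * y) + l1 * (s * x + l0 * y) = (r * l0 + s * l1) * x by ring.
  have -> (x y : F) : - s * (r * x - l1 * y) + r * (s * x + l0 * y) = (r * l0 + s * l1) * y by ring.
  by rewrite rs1 !mul1r.
rewrite -(nproj_mulmx uN (form_scale_invariant formf1)).
have no_line2 : ~ contains_line (fun v => f1 (v *m N)) by move/(contains_line_mulmx uN).
suff : (2 * nproj (fun v => f1 (v *m N) == 0%R) <= 3 * q + 9)%N by lia.
pose b := - l1.
apply: (@nproj_zeros_cubic_normal_form _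
  (k0 * r ^+ 3 + k1 * r ^+ 2 * s + k2 * r * s ^+ 2 + k3 * s ^+ 3)
  (k0 * (3 * r ^+ 2 * b) + k1 * (r ^+ 2 * l0 + 2 * r * b * s)
   + k2 * (2 * r * s * l0 + b * s ^+ 2) + k3 * (3 * s ^+ 2 * l0))
  (k0 * (3 * r * b ^+ 2) + k1 * (2 * r * b * l0 + b ^+ 2 * s)
   + k2 * (r * l0 ^+ 2 + 2 * b * s * l0) + k3 * (3 * s * l0 ^+ 2))
  (k0 * b ^+ 3 + k1 * b ^+ 2 * l0 + k2 * b * l0 ^+ 2 + k3 * l0 ^+ 3)
  (q0 * r ^+ 2 + q1 * r * s + q2 * s ^+ 2)
  (q0 * (2 * r * b) + q1 * (r * l0 + b * s) + q2 * (2 * s * l0))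
  (q0 * b ^+ 2 + q1 * b * l0 + q2 * l0 ^+ 2) odd_q) no_line2 => x y z.
rewrite mulN fE c0.
have -> : l0 * (r * x - l1 * y) + l1 * (s * x + l0 * y) = (r * l0 + s * l1) * x by ring.
by rewrite rs1 /b; ring.
Qed.
End LineFree.

(** * Squares, and affine conics *)

Section Squares.
Variable F : finFieldType.
Local Notation q := #|F|.
Hypothesis odd_q : odd q.

Definition nzsq (x : F) : bool := (x != 0) && [exists w, x == w ^+ 2].

Lemma nzsqP x : reflect (exists2 w, w != 0 & x = w ^+ 2) (nzsq x).
Proof.
apply: (iffP andP) => [[x0 /existsP[w /eqP xE]]|[w w0 ->]].
  by exists w => //; apply: contraNneq x0 => w0; rewrite xE w0 expr0n.
by rewrite expf_neq0 //; split=> //; apply/existsP; exists w.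
Qed.

Lemma nzsq_mul_sq c x : c != 0 -> nzsq (c ^+ 2 * x) = nzsq x.
Proof.
move=> c0; apply/nzsqP/nzsqP => -[w w0 wE]; last first.
  by exists (c * w); rewrite ?mulf_neq0 // exprMn wE.
exists (w / c); first by rewrite mulf_neq0 ?invr_eq0.
by rewrite expr_div_n -wE mulrC mulKf ?expf_neq0.
Qed.

Lemma card_sqrt x : #|[set w | (w != 0%R) && (x == w ^+ 2)%R]| = (2 * nzsq x)%N.
Proof.
case: nzsqP => [[w w0 ->]|nsq]; last first.
  apply/eqP; rewrite muln0 cards_eq0; apply/eqP/setP=> w; rewrite !inE.
  by apply/negbTE/negP=> /andP[w0 /eqP xE]; apply: nsq; exists w.
have w_neqN : w != - w.
  rewrite -subr_eq0 opprK -mulr2n -mulr_natl mulf_neq0 //; exact: odd_card_two_neq0.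
rewrite muln1 -[RHS]/((true).+1) -w_neqN -cards2; apply: eq_card => z; rewrite !inE.
by rewrite [w ^+ 2 == _]eq_sym eqf_sqr andb_idl // => /pred2P[] ->; rewrite ?oppr_eq0.
Qed.

(** Each nonzero square has two square roots, which turns the count of squares among the values of
[h] into a count of points. *)
Lemma card_nzsq (A : finType) (h : A -> F) :
  (2 * #|[set a | nzsq (h a)]|)%N
  = #|[set aw : A * F | (aw.2 != 0%R) && (h aw.1 == aw.2 ^+ 2)%R]|.
Proof.
rewrite (card_pair_fibers (fun a w => (w != 0) && (h a == w ^+ 2))).
under eq_bigr => a _ do rewrite card_sqrt.
by rewrite -big_distrr /= -sum1dep_card big_mkcond.
Qed.

Lemma card_not_nzsq : (2 * #|[set x | ~~ nzsq x]|)%N = q.+1.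
Proof.
have := cardsC [set x | nzsq x].
have -> : ~: [set x | nzsq x] = [set x | ~~ nzsq x] by apply/setP=> x; rewrite !inE.
have := card_nzsq (fun x : F => x).
have -> : #|[set aw : F * F | (aw.2 != 0%R) && (aw.1 == aw.2 ^+ 2)%R]| = #|[set w : F | w != 0%R]|.
  rewrite -(card_imset [set w : F | w != 0] (f := fun w => (w ^+ 2, w))); last by move=> w w' [].
  apply: eq_card => -[x w]; rewrite inE /=; apply/andP/imsetP => [[w0 /eqP ->]|[w']].
    by exists w; rewrite ?inE.
  by rewrite inE => w0 [-> ->].
have := cardsC1 (0 : F); rewrite (_ : [set~ 0] = [set w | w != 0]); last first.
  by apply/setP=> w; rewrite !inE.
move=> -> ; move=> E1 /(congr1 (muln 2)); rewrite mulnDr E1.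
by have := finNzRing_gt1 F; move: #|F| => n; lia.
Qed.

(** The change of variables t = y + w, e / t = y - w. *)
Lemma card_hyperbola e : e != 0 -> #|[set yw : F * F | (yw.1 ^+ 2 - e == yw.2 ^+ 2)%R]| = q.-1.
Proof.
move=> e0; have two_neq0 := odd_card_two_neq0 odd_q.
rewrite -(cardsC1 (0 : F)).
rewrite -(card_in_imset (D := [set~ 0]) (f := fun t => ((t + e / t) / 2, (t - e / t) / 2))).
  apply: eq_card => -[y w]; rewrite inE /=; apply/eqP/imsetP => [ywe|[t]].
    have ywE : (y + w) * (y - w) = e by rewrite -[e](subKr (y ^+ 2)) ywe; ring.
    have t0 : y + w != 0 by apply: contraNneq e0 => t0; rewrite -ywE t0 mul0r.
    exists (y + w); first by rewrite !inE.
    have -> : e / (y + w) = y - w by rewrite -ywE mulrC mulKf.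
    by congr (_, _); apply: (mulIf two_neq0); rewrite divfK //; ring.
  rewrite !inE => t0 [-> ->]; field; exact/andP.
have half_inj := mulIf (invr_neq0 two_neq0).
move=> t t'; rewrite !inE => t0 t'0 [/half_inj E1 /half_inj E2].
apply: (mulIf two_neq0).
have -> : t * 2 = (t + e / t) + (t - e / t) by ring.
by rewrite E1 E2; ring.
Qed.

(** The points of the hyperbola y^2 - w^2 = e with w <> 0 count twice the y for which y^2 - e is a
nonzero square, and those with w = 0 are the square roots of e. *)
Lemma card_not_nzsq_shift e : e != 0 ->
  (2 * #|[set y | ~~ nzsq (y ^+ 2 - e)%R]|)%N = (q + 1 + 2 * nzsq e)%N.
Proof.
move=> e0; have := card_hyperbola e0.
pose H := [set yw : F * F | (yw.1 ^+ 2 - e == yw.2 ^+ 2)].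
rewrite -/H -(cardsID [set yw | yw.2 != 0] H).
have -> : #|H :&: [set yw | yw.2 != 0]| = (2 * #|[set y | nzsq (y ^+ 2 - e)%R]|)%N.
  by rewrite card_nzsq; apply: eq_card => yw; rewrite !inE andbC.
have -> : #|H :\: [set yw | yw.2 != 0]| = (2 * nzsq e)%N.
  rewrite -card_sqrt -(card_imset [set w | (w != 0) && (e == w ^+ 2)]
    (f := fun w : F => (w, 0 : F))); last by move=> w w' [].
  apply: eq_card => -[y w]; rewrite !inE /= negbK; apply/andP/imsetP => [[/eqP -> /eqP]|[w']].
    rewrite expr0n => /subr0_eq ye; exists y => //; rewrite inE -ye eqxx andbT.
    by apply: contraNneq e0 => y0; rewrite -ye y0 expr0n.
  by rewrite inE => /andP[_ /eqP ->] [-> ->]; rewrite subrr expr0n !eqxx.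
have := cardsC [set y | nzsq (y ^+ 2 - e)].
have -> : ~: [set y | nzsq (y ^+ 2 - e)] = [set y | ~~ nzsq (y ^+ 2 - e)].
  by apply/setP=> x; rewrite !inE.
move=> /(congr1 (muln 2)); rewrite mulnDr.
move: (finNzRing_gt1 F); move: (2 * #|[set y | nzsq (y ^+ 2 - e)%R]|)%N => m.
by move: #|F| => n; case: nzsq => /=; lia.
Qed.

Lemma card_not_nzsq_shift_le e :
  (2 * #|[set y | ~~ nzsq (y ^+ 2 - e)%R]| <= q + 3)%N.
Proof.
have [->|e0] := eqVneq e 0; last by rewrite card_not_nzsq_shift //; case: nzsq; lia.
rewrite (_ : [set y | _] = [set 0]) ?cards1; first by have := finNzRing_gt1 F; lia.
apply/setP=> y; rewrite !inE subr0; apply/idP/eqP => [|->].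
  by apply: contraNeq => y0; apply/nzsqP; exists y.
by rewrite expr0n; apply/nzsqP=> -[w w0 /esym/eqP]; rewrite expf_eq0 (negPf w0).
Qed.
End Squares.

(** * Zeros of forms on the conic and its internal points *)

Section BHSet.
Variable F : finFieldType.
Local Notation q := #|F|.
Local Notation V := 'rV[F]_3.
Hypothesis odd_q : odd q.
Implicit Types (f : V -> F) (v : V).

(** The discriminant of the quadratic v0 X^2 - v1 X + v2 whose roots are the parameters
of the point [v]. *)
Definition disc v : F := v 0 1 ^+ 2 - 4 * v 0 0 * v 0 2%:R.
Definition inBH v : bool := ~~ nzsq (disc v).
Definition BH_nzeros f : nat := nproj (fun v => inBH v && (f v == 0)).

Lemma disc_vec3 x y z : disc (vec3 x y z) = y ^+ 2 - 4 * x * z.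
Proof. by rewrite /disc !vec3E. Qed.

Lemma inBH_scale_invariant : scale_invariant inBH.
Proof.
move=> c v c0; rewrite /inBH; congr (~~ _); rewrite -(nzsq_mul_sq (disc v) c0); congr nzsq.
by rewrite [v]vec3_eta scale_vec3 !disc_vec3; ring.
Qed.

Lemma four_neq0 : 4 != 0 :> F.
Proof.
by rewrite (_ : 4 = 2 * 2) ?mulf_neq0 ?odd_card_two_neq0 // -natrM.
Qed.

(** On the line at infinity v0 = 0 only (0 : 0 : 1) is left, as disc (0 : 1 : z) = 1. *)
Lemma nproj_BH (Phi : pred V) : nproj (fun v => inBH v && Phi v)
  = (\sum_y #|[set z | ~~ nzsq (y ^+ 2 - 4 * z)%R && Phi (vec3 1 y z)]| + Phi (vec3 0 0 1))%N.
Proof.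
rewrite nproj_affine (card_pair_fibers (fun y z => inBH (vec3 1 y z) && Phi (vec3 1 y z))).
rewrite (_ : [set b | _] = set0) ?cards0 ?addn0; last first.
  apply/setP=> b; rewrite !inE /inBH disc_vec3; apply/negbTE; rewrite negb_and negbK.
  apply/orP; left; apply/nzsqP; exists 1; rewrite ?oner_eq0 //; ring.
congr (_ + nat_of_bool _)%N.
  by apply: eq_bigr => y _; apply: eq_card => z; rewrite !inE /inBH disc_vec3 mulr1.
rewrite /inBH disc_vec3 mulr0 mul0r subr0 expr0n /=.
by have -> : nzsq (0 : F) = false by apply/nzsqP=> -[w w0 /esym/eqP]; rewrite expf_eq0 (negPf w0).
Qed.

Lemma card_affine_not_nzsq (r s : F) : r != 0 ->
  #|[set z | ~~ nzsq (s - r * z)]| = #|[set x : F | ~~ nzsq x]|.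
Proof.
move=> r0.
rewrite -(card_imset [set z | ~~ nzsq (s - r * z)] (f := fun z => s - r * z)); last first.
  by move=> z z' /addrI /oppr_inj /(mulfI r0).
apply: eq_card => x; rewrite inE; apply/imsetP/idP => [[z]|nx]; first by rewrite inE => ? ->.
by exists ((s - x) / r); rewrite ?inE mulrC divfK // subKr.
Qed.

Lemma nproj_inBH : (2 * nproj inBH = q ^ 2 + q + 2)%N.
Proof.
have -> : nproj inBH = nproj (fun v => inBH v && true) by apply: eq_nproj => v _; rewrite andbT.
rewrite nproj_BH (eq_bigr (fun=> #|[set x : F | ~~ nzsq x]|)); last first.
  move=> y _; rewrite -(card_affine_not_nzsq (y ^+ 2) four_neq0).
  by apply: eq_card => z; rewrite !inE andbT.
rewrite sum_nat_const mulnDr mulnCA card_not_nzsq // cardT -cardE; lia.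
Qed.

(** Completing the square along the line s x + r y + z = 0. *)
Lemma nproj_BH_graph (r s : F) :
  (\sum_y #|[set z : F | ~~ nzsq (y ^+ 2 - 4 * z)%R && (z == - (s + r * y))%R]|)%N
  = #|[set y | ~~ nzsq (y ^+ 2 - 4 * (r ^+ 2 - s))%R]|.
Proof.
rewrite (card_graph_fibers (fun y z => ~~ nzsq (y ^+ 2 - 4 * z))).
rewrite -(card_imset [set y | ~~ nzsq (y ^+ 2 - 4 * - (s + r * y))] (@addrI F (2 * r))).
have yE y : (2 * r + y) ^+ 2 - 4 * (r ^+ 2 - s) = y ^+ 2 - 4 * - (s + r * y) by ring.
apply: eq_card => y; apply/imsetP/idP => [[x]|]; first by rewrite !inE -yE => + ->.
rewrite inE => ny; exists (y - 2 * r); last by rewrite [RHS]addrC subrK.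
by rewrite inE -yE [2 * r + _]addrC subrK.
Qed.

(** A line not through (0 : 0 : 1) is a graph over y.  One through that point has it as its only
point if it is the tangent v0 = 0, and otherwise the values of disc on it run through F. *)
Lemma BH_nzeros_line (k0 k1 k2 : F) : [|| k0 != 0, k1 != 0 | k2 != 0] ->
  (2 * BH_nzeros (fun v => v 0 0 * k0 + v 0 1 * k1 + v 0 2%:R * k2)%R <= q + 3)%N.
Proof.
move=> k_neq0; rewrite /BH_nzeros.
rewrite (nproj_BH (fun v => v 0 0 * k0 + v 0 1 * k1 + v 0 2%:R * k2 == 0)).
rewrite !vec3E !mul0r !add0r mul1r.
have [k20|k2_neq0] := eqVneq k2 0; last first.
  rewrite addn0 (eq_bigr (fun y =>
    #|[set z | ~~ nzsq (y ^+ 2 - 4 * z) && (z == - (k0 / k2 + k1 / k2 * y))]|)).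
    by rewrite nproj_BH_graph card_not_nzsq_shift_le.
  move=> y _; apply: eq_card => z; rewrite !inE !vec3E; congr (_ && _).
  rewrite -[RHS](inj_eq (mulIf k2_neq0)) -[RHS]subr_eq0; congr (_ == 0).
  by field; exact: k2_neq0.
have := finNzRing_gt1 F; rewrite k20 in k_neq0 *.
have [k10|k1_neq0] := eqVneq k1 0.
  rewrite big1 => [|y _]; first lia.
  apply: eq_card0 => z; rewrite !inE !vec3E k10 !mulr0 mul1r !addr0.
  by rewrite k10 eqxx !orbF in k_neq0; rewrite (negPf k_neq0) andbF.
rewrite (bigD1 (- k0 / k1)) //= big1 => [|y y_neq]; last first.
  apply: eq_card0 => z; rewrite !inE !vec3E mul1r mulr0 addr0; apply/negbTE.
  rewrite negb_and; apply/orP; right; apply: contraNneq y_neq => k_eq0.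
  by rewrite -(inj_eq (mulIf k1_neq0)) divfK // -addr_eq0 addrC k_eq0.
have := card_not_nzsq odd_q; rewrite -(card_affine_not_nzsq ((- k0 / k1) ^+ 2) four_neq0).
have -> : [set z | ~~ nzsq ((- k0 / k1) ^+ 2 - 4 * z) &&
   (vec3 1 (- k0 / k1) z 0 0 * k0 + vec3 1 (- k0 / k1) z 0 1 * k1
    + vec3 1 (- k0 / k1) z 0 2%:R * 0 == 0)]
   = [set z | ~~ nzsq ((- k0 / k1) ^+ 2 - 4 * z)].
  by apply/setP=> z; rewrite !inE !vec3E mul1r mulr0 addr0 divfK // subrr eqxx andbT.
by rewrite addn0 addn1 mulnS => -> _; rewrite add2n addn3.
Qed.

(** The lines through (0 : 1 : 0), which is off B; the constant e of [card_not_nzsq_shift] is then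
4 l, a nonzero square. *)
Lemma BH_nzeros_secant (l : F) : nzsq l ->
  (2 * BH_nzeros (fun v => v 0 2%:R - l * v 0 0)%R = q + 3)%N.
Proof.
move=> sq_l; rewrite /BH_nzeros (nproj_BH (fun v => v 0 2%:R - l * v 0 0 == 0)).
rewrite !vec3E mulr0 subr0 oner_eq0 addn0.
rewrite (eq_bigr (fun y => #|[set z | ~~ nzsq (y ^+ 2 - 4 * z) && (z == - (- l + 0 * y))]|)).
  have l0 : l != 0 by case/andP: sq_l.
  rewrite nproj_BH_graph card_not_nzsq_shift //; last first.
    by rewrite expr0n sub0r opprK mulf_neq0 ?four_neq0.
  have -> : 4 * (0 ^+ 2 - - l) = 2 ^+ 2 * l by ring.
  by rewrite nzsq_mul_sq ?odd_card_two_neq0 // sq_l; lia.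
move=> y _; apply: eq_card => z; rewrite !inE !vec3E mulr1 mul0r addr0 opprK.
by rewrite subr_eq0.
Qed.

(** Lines split off one at a time, each taking at most (q + 3) / 2 points; what is left when none
remains satisfies the same bound in the whole plane. *)
Lemma BH_nzeros_form d f : (d <= 3)%N -> is_form d f -> (exists v, f v != 0) ->
  (2 * BH_nzeros f <= d * (q + 3))%N.
Proof.
elim: d f => [|d IHd] f d_le3 formf [v0 fv0].
  rewrite /BH_nzeros (_ : nproj _ = 0%N) //; apply: eq_card0 => v; rewrite !inE.
  by case: formf => c fE; rewrite fE -(fE v0) (negPf fv0) !andbF.
have [[a a0 fa]|no_line] := pselect (contains_line f); last first.
  apply: leq_trans (nproj_zeros_line_free odd_q d_le3 formf no_line).
  by rewrite leq_mul2l nproj_leq // => v _ /andP[].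
have [f0 formf0 fE] := form_line_factor formf a0 fa.
have f0_neq0 : exists v, f0 v != 0.
  by exists v0; apply: contraNneq fv0 => f00; rewrite fE f00 mulr0.
pose l v := v 0 0 * a 0 0 + v 0 1 * a 1 0 + v 0 2%:R * a 2%:R 0.
have lE v : (v *m a) 0 0 = l v by rewrite mxE sum3E.
have l_bound : (2 * BH_nzeros l <= q + 3)%N.
  apply: BH_nzeros_line; move: a0; apply: contraNT.
  rewrite !negb_or !negbK => /and3P[/eqP a00 /eqP a10 /eqP a20].
  by apply/eqP/colP; apply: ord3P; rewrite mxE.
rewrite [X in (_ <= X)%N]mulSn.
apply: leq_trans (leq_add l_bound (IHd _ (ltnW d_le3) formf0 f0_neq0)).
rewrite -mulnDr leq_mul2l; apply: leq_trans (nprojU _ _); apply: nproj_leq => v _.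
by case/andP=> -> /=; rewrite fE lE mulf_eq0.
Qed.
End BHSet.

(** * The rational points of the Ballico-Hefez curve *)

Section RationalPoints.
Variables (F : finFieldType) (L : closedFieldType) (iota : {rmorphism F -> L}).
Local Notation q := #|F|.
Hypothesis odd_q : odd q.
Implicit Types (v : 'rV[F]_3) (x y : L).

Lemma frobeniusD x y : (x + y) ^+ q = x ^+ q + y ^+ q.
Proof.
have [p p_pr pcharFp] := finPcharP F.
apply: exprDn_pchar; rewrite (eq_pnat _ (pcharf_eq (rmorph_pchar iota pcharFp))).
by rewrite -(eq_pnat _ (pcharf_eq pcharFp)) pnat_pchar_card.
Qed.

Lemma frobeniusN x : (- x) ^+ q = - x ^+ q.
Proof. by rewrite exprNn -signr_odd odd_q mulN1r. Qed.

Lemma frobenius_rat (a : F) : iota a ^+ q = iota a.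
Proof. by rewrite -rmorphXn expf_card. Qed.

(** X^q - X already has q roots in F. *)
Lemma frobenius_fixed x : x ^+ q = x -> exists a, x = iota a.
Proof.
move=> xq; have := congr1 (fun p => (map_poly iota p).[x]) (finField_genPoly F).
rewrite rmorphB /= map_polyXn map_polyX rmorph_prod horner_prod !hornerE xq subrr => /esym/eqP.
rewrite prodf_seq_eq0 => /hasP[a _] /=; rewrite rmorphB /= map_polyX map_polyC hornerXsubC subr_eq0.
by move/eqP=> xE; exists a.
Qed.

(** disc is the square of c (s^q t - s t^q).  If that number came from F and were nonzero, then
c s^q t would be rational, as c s^(q+1) is, and being fixed by Frobenius they force
s^q t = s t^q. *)
Lemma on_BH_inBH v : on_BH q (map_mx iota v) -> inBH v.
Proof.
case=> s [t [c [st0 c0 /rowP vE]]].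
have := vE 0; rewrite !mxE /= => v0E; have := vE 1; rewrite !mxE /= => v1E.
have := vE 2%:R; rewrite !mxE /= => v2E.
apply/nzsqP=> -[w w0 discE].
have : (iota w) ^+ 2 = (c * (s ^+ q * t) - c * (s * t ^+ q)) ^+ 2.
  rewrite -rmorphXn -discE /disc rmorphB rmorphXn !rmorphM rmorph_nat.
  by rewrite v0E v1E v2E !exprS; ring.
set A := c * (s ^+ q * t); set B := c * (s * t ^+ q) => sqE.
have two_neq0 : iota 2 != 0 by rewrite fmorph_eq0 odd_card_two_neq0.
have AB_neq : A != B.
  apply: contraNneq w0 => AB; rewrite AB subrr expr0n /= in sqE.
  by move/eqP: sqE; rewrite expf_eq0 fmorph_eq0.
have [e AE] : exists e, A = iota e.
  have [w' w'E] : exists w', A - B = iota w'.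
    move/eqP: sqE; rewrite eq_sym eqf_sqr => /pred2P[] ->; first by exists w.
    by exists (- w); rewrite rmorphN.
  exists ((v 0 1 + w') / 2); apply: (mulIf two_neq0).
  rewrite -rmorphM divfK ?odd_card_two_neq0 // [RHS]rmorphD -w'E v1E rmorph_nat /A /B; ring.
have s0 : s != 0.
  apply: contraNneq AB_neq => s0.
  by rewrite /A /B s0 expr0n (gtn_eqF (ltnW (finNzRing_gt1 F))) !mul0r.
have := frobenius_rat (v 0 0); rewrite v0E => v0q.
have := frobenius_rat e; rewrite -AE => Aq.
(* Frobenius fixes c s^(q+1) *)
have csq : c ^+ q * (s ^+ q) ^+ q = c * s.
  apply: (mulIf (expf_neq0 q s0)).
  transitivity (c * (s * s ^+ q)); last by rewrite mulrA.
  by move: v0q; rewrite exprS !exprMn => <-; ring.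
case/negP: AB_neq; apply/eqP; rewrite -Aq /A /B !exprMn mulrA csq; ring.
Qed.

(** Frobenius sends a root u of X^2 - a X + b to a root.  If it is the other one, u is the parameter
of the point; if it is u itself then u is in F and disc is a square, hence zero, so that both roots
coincide. *)
Lemma inBH_on_BH v : v != 0 -> inBH v -> on_BH q (map_mx iota v).
Proof.
move=> v_neq0 inv; have q_gt0 := ltnW (finNzRing_gt1 F).
have [v00|v00] := eqVneq (v 0 0) 0.
  have v10 : v 0 1 = 0.
    apply: contraNeq inv => v10; apply/nzsqP; exists (v 0 1) => //.
    by rewrite /disc v00; ring.
  exists 0, 1, (iota (v 0 2%:R)); split.
  - by rewrite xpair_eqE oner_eq0 andbF.
  - rewrite fmorph_eq0; apply: contraNneq v_neq0 => v20.
    by apply/eqP/rowP; apply: ord3P; rewrite ?v00 ?v10 ?v20 mxE.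
  apply/rowP; apply: ord3P; rewrite !mxE /= ?v00 ?v10 ?rmorph0.
  - by rewrite exprS mul0r mulr0.
  - by rewrite expr0n gtn_eqF // !mul0r addr0 mulr0.
  by rewrite expr1n mulr1.
pose a := v 0 1 / v 0 0; pose b := v 0 2%:R / v 0 0.
(* a parameter of the point, in L *)
have [u uE] : exists u : L, u ^+ 2 = iota a * u - iota b.
  have [u uE] := @solve_monicpoly L 2 (fun i => if i == 0%N then - iota b else iota a) isT.
  by exists u; rewrite uE !big_ord_recr big_ord0 /= add0r expr0 mulr1 addrC.
have uqE : (u ^+ q) ^+ 2 = iota a * u ^+ q - iota b.
  by rewrite -exprM mulnC exprM uE frobeniusD frobeniusN exprMn !frobenius_rat.
have conj : u ^+ q = iota a - u.
  have : (u ^+ q - u) * (u ^+ q - (iota a - u)) = 0.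
    transitivity ((u ^+ q) ^+ 2 - u ^+ 2 - iota a * (u ^+ q - u)); first by ring.
    by rewrite uqE uE; ring.
  move/eqP; rewrite mulf_eq0 !subr_eq0 => /pred2P[uq|//].
  have [e ue] := frobenius_fixed uq.
  have disc_e : disc v = (v 0 0 * (2 * e - a)) ^+ 2.
    have : e ^+ 2 = a * e - b by apply: (fmorph_inj iota); rewrite rmorphXn rmorphB rmorphM /= -ue.
    move=> e2; transitivity (v 0 0 ^+ 2 * (a ^+ 2 - 4 * b)).
      by rewrite /disc /a /b; field.
    rewrite (_ : b = a * e - e ^+ 2); first by ring.
    by rewrite e2; ring.
  have : v 0 0 * (2 * e - a) = 0.
    by apply: contraNeq inv => nz; apply/nzsqP; exists (v 0 0 * (2 * e - a)).
  move/eqP; rewrite mulf_eq0 (negPf v00) subr_eq0 => /eqP aE.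
  by rewrite uq -aE ue rmorphM rmorph_nat; ring.
exists 1, u, (iota (v 0 0)); split.
- by rewrite xpair_eqE oner_eq0.
- by rewrite fmorph_eq0.
apply/rowP; apply: ord3P; rewrite !mxE /= ?expr1n ?mul1r ?mulr1 //.
- by rewrite conj addrC subrK -rmorphM /a mulrC divfK.
rewrite exprS conj mulrBr -expr2 uE mulrC; rewrite opprB addrCA [u * _]mulrC subrr addr0.
by rewrite -rmorphM /b divfK.
Qed.

Lemma BH_point_inBH v : v != 0 ->
  `[< exists2 w, w \in proj_point v & on_BH q (map_mx iota w) >] = inBH v.
Proof.
move=> v0; apply/asboolP/idP => [[w /imsetP[c]]|inv].
  by rewrite inE => c0 -> /on_BH_inBH; rewrite inBH_scale_invariant.
exists v; last exact: inBH_on_BH.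
by apply/imsetP; exists 1; rewrite ?inE ?oner_eq0 ?scale1r.
Qed.

Lemma card_BH_points (Psi : pred {set 'rV[F]_3}) (Phi : pred 'rV[F]_3) :
  (forall v, v != 0 -> inBH v -> Psi (proj_point v) = Phi v) ->
  #|[set P in BH_points iota | Psi P]| = nproj (fun v => inBH v && Phi v).
Proof.
move=> PsiE; rewrite -(card_proj_points (Psi := fun P => (P \in BH_points iota) && Psi P)).
  by apply: eq_card => P; rewrite !inE; case: (P \in proj_plane F).
move=> v v0; rewrite inE -BH_point_inBH //.
have -> : proj_point v \in proj_plane F by apply/imsetP; exists v; rewrite ?inE.
by rewrite /= BH_point_inBH //; case inv: (inBH v) => //=; rewrite PsiE.
Qed.
End RationalPoints.

(** * Homogeneous polynomials as forms *)

Section HomogeneousPolynomials.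
Variable F : finFieldType.
Local Notation q := #|F|.
Local Notation o0 := (0%R : 'I_3).
Local Notation o1 := (1%R : 'I_3).
Local Notation o2 := (2%:R%R : 'I_3).
Implicit Types (p : {mpoly F[3]}) (v : 'rV[F]_3).

Definition mpoly_fun p v : F := p.@[fun k => v 0 k].

Lemma is_form_monomial (i j k : nat) :
  is_form (i + j + k) (fun v : 'rV[F]_3 => v 0 0 ^+ i * v 0 1 ^+ j * v 0 2%:R ^+ k).
Proof.
elim: i => [|i IHi]; last first.
  by apply: eq_form (form_coord 0 IHi) => v; rewrite exprS !mulrA.
elim: j => [|j IHj]; last first.
  by apply: eq_form (form_coord 1 IHj) => v; rewrite !expr0 !mul1r exprS mulrA.
elim: k => [|k IHk]; first by exists 1 => v; rewrite !expr0 !mulr1.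
by apply: eq_form (form_coord 2%:R IHk) => v; rewrite !expr0 !mul1r exprS.
Qed.

Lemma mdeg3 (m : 'X_{1..3}) : mdeg m = (m o0 + m o1 + m o2)%N.
Proof. by rewrite mdegE (sum3E (m : 'I_3 -> nat)). Qed.

Lemma mpoly_funE p v : mpoly_fun p v
  = \sum_(m <- msupp p) p@_m * (v 0 0 ^+ m o0 * v 0 1 ^+ m o1 * v 0 2%:R ^+ m o2).
Proof.
rewrite /mpoly_fun mevalE; apply: eq_bigr => m _; congr (_ * _).
rewrite !big_ord_recr big_ord0 /= mul1r.
by congr (v 0 _ ^+ m _ * v 0 _ ^+ m _ * v 0 _ ^+ m _); apply: val_inj.
Qed.

Lemma is_form_mpoly_fun d p : p \is d.-homog -> is_form d (mpoly_fun p).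
Proof.
move=> /dhomogP homog_p; apply: (@eq_form _ _ _ _ (fun v => esym (mpoly_funE p v))).
apply: (@eq_form _ _ (fun v => \sum_(m <- msupp p | m \in msupp p)
   p@_m * (v 0 0 ^+ m o0 * v 0 1 ^+ m o1 * v 0 2%:R ^+ m o2))).
  by move=> v; rewrite [RHS]big_seq_cond big_mkcondr.
apply: form_sum => m m_supp; apply: form_scale.
have <- : mdeg m = d := homog_p m m_supp.
by rewrite mdeg3; apply: is_form_monomial.
Qed.

(** A polynomial function of degree less than q determines its coefficients. *)
Lemma power_sum_eq0 (T : eqType) (s : seq T) (a : T -> F) (e : T -> nat) :
  {in s, forall t, (e t < q)%N} -> (forall x, \sum_(t <- s) a t * x ^+ e t = 0) ->
  forall i, \sum_(t <- [seq t <- s | e t == i]) a t = 0.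
Proof.
move=> lt_e sum0 i; pose P : {poly F} := \sum_(t <- s) a t *: 'X^(e t).
have PE : P = 0.
  apply/eqP; apply: contraTT isT => P0.
  have /(max_poly_roots P0) : all (root P) (enum F).
    apply/allP=> x _; apply/rootP; rewrite horner_sum -[RHS](sum0 x).
    by apply: eq_bigr => t _; rewrite hornerZ hornerXn.
  move=> /(_ (enum_uniq F)); rewrite -cardE ltnNge; case/negP.
  rewrite /P big_seq; elim/big_ind: _ => [|f g sf sg|t t_s]; first by rewrite size_poly0.
    by rewrite size_polyD_leq.
  by apply: leq_trans (size_scale_leq _ _) _; rewrite size_polyXn lt_e.
have := congr1 (fun f : {poly F} => f`_i) PE; rewrite coef0 coef_sum => sum_coef.
rewrite -[RHS]sum_coef big_filter big_mkcond; apply: eq_bigr => t _.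
by rewrite coefZ coefXn eq_sym; case: eqP; rewrite ?mulr1 ?mulr0.
Qed.

(** [power_sum_eq0] applied to the three variables in turn. *)
Lemma mpoly_fun_eq0 d p : p \is d.-homog -> (d < q)%N ->
  (forall v, mpoly_fun p v = 0) -> p = 0.
Proof.
move=> /dhomogP homog_p lt_dq p0; apply/eqP; rewrite -msupp_eq0; apply/eqP.
case Es: (msupp p) => [//|m s]; have m_supp : m \in msupp p by rewrite Es mem_head.
have lt_q i : {in msupp p, forall t : 'X_{1..3}, (t i < q)%N}.
  move=> t t_supp; apply: leq_ltn_trans lt_dq.
  have <- : mdeg t = d := homog_p t t_supp.
  by rewrite mdegE (bigD1 i) //= leq_addr.
have step0 y z := power_sum_eq0 (e := fun t : 'X_{1..3} => t o0) (lt_q 0)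
  (a := fun t : 'X_{1..3} => p@_t * (y ^+ t o1 * z ^+ t o2)).
have {step0} E0 y z : \sum_(t <- [seq t : 'X_{1..3} <- msupp p | t o0 == m o0])
    p@_t * (y ^+ t o1 * z ^+ t o2) = 0.
  apply: step0 => x; rewrite -[RHS](p0 (vec3 x y z)) mpoly_funE.
  by apply: eq_bigr => t _; rewrite !vec3E; ring.
set s0 := [seq t <- _ | _] in E0.
have E1 z : \sum_(t <- [seq t : 'X_{1..3} <- s0 | t o1 == m o1]) p@_t * z ^+ t o2 = 0.
  apply: (power_sum_eq0 (e := fun t : 'X_{1..3} => t o1)
    (a := fun t : 'X_{1..3} => p@_t * z ^+ t o2)) => [t|y].
    by rewrite mem_filter => /andP[_]; apply: lt_q.
  by rewrite -[RHS](E0 y z); apply: eq_bigr => t _; ring.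
set s1 := [seq t <- s0 | _] in E1.
have E2 : \sum_(t <- [seq t : 'X_{1..3} <- s1 | t o2 == m o2]) p@_t = 0.
  apply: (power_sum_eq0 (e := fun t : 'X_{1..3} => t o2)) => [t|z]; last exact: E1.
  by rewrite !mem_filter => /and3P[_ _]; apply: lt_q.
have : p@_m = 0.
  rewrite -E2 /s1 /s0 -!filter_predI -(big_seq1 (GRing.add (s := F)) m (fun t => p@_t)).
  rewrite -(filter_pred1_uniq (msupp_uniq p) m_supp); congr (\sum_(t <- _) _).
  apply: eq_filter => t; rewrite /= -andbA.
  apply/eqP/and3P => [->|[/eqP t2 /eqP t1 /eqP t0]]; first by rewrite !eqxx.
  by apply/mnmP; apply: ord3P.
by move/eqP; rewrite mcoeff_eq0 m_supp.
Qed.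

Lemma exists_product_form (s : seq F) : exists2 p : {mpoly F[3]}, p \is (size s).-homog &
  forall v, mpoly_fun p v = \prod_(l <- s) (v 0 2%:R - l * v 0 0).
Proof.
elim: s => [|l s [p homog_p pE]].
  by exists 1; rewrite ?dhomog1 // => v; rewrite big_nil /mpoly_fun meval1.
exists (('X_2%:R - l *: 'X_0) * p).
  rewrite -[size _]add1n; apply: dhomogM homog_p.
  have homog_X i : 'X_i \is [in F[3], 1.-homog] by rewrite dhomogX; apply/eqP/mdeg1.
  by rewrite dhomogD ?dhomogN ?dhomogZ.
by move=> v; rewrite big_cons -pE /mpoly_fun mevalM mevalB mevalZ !mevalXU.
Qed.
End HomogeneousPolynomials.

(** * The codes *)

Section BHCode.
Variables (F : finFieldType) (L : closedFieldType) (iota : {rmorphism F -> L}).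
Variable rep : {set 'rV[F]_3} -> 'rV[F]_3.
Local Notation q := #|F|.
Hypothesis odd_q : odd q.
Hypothesis repP : forall P, P \in BH_points iota -> rep P \in P.
Local Notation S := (BH_points iota).
Implicit Types (f : 'rV[F]_3 -> F).

Lemma card_BH : (2 * #|S| = q ^ 2 + q + 2)%N.
Proof.
rewrite -(nproj_inBH odd_q).
rewrite (@eq_nproj F (@inBH F) (fun v => inBH v && true)); last by move=> v _; rewrite andbT.
rewrite -(card_BH_points iota odd_q (Psi := fun=> true)) //.
by congr (2 * _)%N; apply: eq_card => P; rewrite [RHS]inE andbT.
Qed.

Lemma card_BH_zeros d f : is_form d f -> #|[set P in S | f (rep P) == 0]| = BH_nzeros f.
Proof.
move=> formf; apply: (card_BH_points iota odd_q) => v v0 inv.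
have /imsetP[c] : rep (proj_point v) \in proj_point v.
  apply: repP; rewrite inE BH_point_inBH // inv andbT.
  by apply/imsetP; exists v; rewrite ?inE.
by rewrite inE => c0 ->; rewrite (form_scale_invariant formf).
Qed.

Lemma card_BH_nonzeros d f : is_form d f ->
  #|[set j : 'I_#|S| | f (rep (enum_val j)) != 0]| = (#|S| - BH_nzeros f)%N.
Proof.
move=> formf; rewrite -(card_BH_zeros formf).
have -> : (#|S| - #|[set P in S | f (rep P) == 0%R]|)%N = #|[set P in S | f (rep P) != 0%R]|.
  rewrite -(cardsID [set P | f (rep P) == 0] S).
  rewrite [X in (X + _ - _)%N](_ : _ = #|[set P in S | f (rep P) == 0%R]|).
    by rewrite addKn; apply: eq_card => P; rewrite !inE andbC.
  by apply: eq_card => P; rewrite !inE.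
rewrite -(card_imset _ enum_val_inj); apply: eq_card => P.
apply/imsetP/setIdP => [[j]|[PS fP]].
  by rewrite inE => fj ->; split=> //; apply: enum_valP.
exists (enum_rank_in PS P); last by rewrite enum_rankK_in.
by rewrite inE enum_rankK_in.
Qed.

(** Two distinct lines v2 = l v0 meet only at (0 : 1 : 0), which is not on B. *)
Lemma BH_nzeros_secants (s : seq F) : uniq s -> all (@nzsq F) s ->
  (2 * BH_nzeros (fun v : 'rV[F]_3 => (\prod_(l <- s) (v 0 2%:R - l * v 0 0))%R)
   = size s * (q + 3))%N.
Proof.
elim: s => [_ _|l s IHs /= /andP[l_s uniq_s] /andP[sq_l sq_s]].
  rewrite /BH_nzeros (_ : nproj _ = 0%N) //; apply: eq_card0 => v; rewrite !inE big_nil.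
  by rewrite oner_eq0 !andbF.
rewrite [RHS]mulSn -[X in (X + _)%N](BH_nzeros_secant odd_q sq_l) -IHs // -mulnDr; congr (2 * _)%N.
rewrite /BH_nzeros -nprojU_disjoint => [|v v0].
  by apply: eq_nproj => v _; rewrite big_cons mulf_eq0 andb_orr.
apply/negP => /andP[/andP[inv /eqP/subr0_eq v2l] /andP[_]].
rewrite prodf_seq_eq0 => /hasP[l' l's /=]; rewrite v2l -mulrBl mulf_eq0 subr_eq0.
case/orP=> [/eqP ll'|/eqP v00]; first by rewrite ll' l's in l_s.
have v1_neq0 : v 0 1 != 0.
  apply: contraNneq v0 => v10; apply/eqP/rowP; apply: ord3P; rewrite mxE //.
  by rewrite v2l v00 mulr0.
by case/nzsqP: inv; exists (v 0 1); rewrite // /disc v00; ring.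
Qed.

Lemma exists_nzsq_seq d : (2 * d < q)%N ->
  exists s : seq F, [/\ size s = d, uniq s & all (@nzsq F) s].
Proof.
move=> lt_dq; exists (take d (enum [set x : F | nzsq x])).
have card_sq := card_not_nzsq odd_q.
have le_d : (d <= #|[set x : F | nzsq x]|)%N.
  have := cardsC [set x : F | nzsq x].
  have -> : ~: [set x : F | nzsq x] = [set x | ~~ nzsq x] by apply/setP=> x; rewrite !inE.
  move: card_sq lt_dq.
  by move: #|F| #|[set x : F | nzsq x]| #|[set x : F | ~~ nzsq x]| => n a b; lia.
split; first by rewrite size_takel // -cardE.
  by rewrite take_uniq // enum_uniq.
by apply/allP=> x /mem_take; rewrite mem_enum inE.
Qed.

(** The condition 2 d < q provides d secants through (0 : 1 : 0).  It also makes d (q + 3) / 2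
smaller than the number of points, which gives injectivity of evaluation. *)
Lemma is_code_BH d : (0 < d <= 3)%N -> (2 * d < q)%N ->
  is_code (code_L S rep d) ((q ^ 2 + q + 2) %/ 2) 'C(d + 2, d)
    ((q ^ 2 + q + 2) %/ 2 - (d * (q + 3)) %/ 2)%N.
Proof.
move=> /andP[d_gt0 d_le3] lt_dq; rewrite -card_BH mulKn //.
have few_zeros : (d * (q + 3) < 2 * #|S|)%N by rewrite card_BH; nia.
have zeros_le f : is_form d f -> (exists v, f v != 0) -> (2 * BH_nzeros f <= d * (q + 3))%N.
  exact: BH_nzeros_form.
pose ev : 'Hom(dhomog 3 F d, 'rV[F]_#|S|) := linfun (@eval_points F S rep d).
have evE (p : dhomog 3 F d) j : ev p 0 j = mpoly_fun p (rep (enum_val j)).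
  by rewrite /ev lfunE /= mxE.
have form_p (p : dhomog 3 F d) : is_form d (mpoly_fun p).
  exact: is_form_mpoly_fun (dhomog_is_dhomog p).
have distE (x y : dhomog 3 F d) :
    hamming_dist (ev x) (ev y) = (#|S| - BH_nzeros (mpoly_fun (x - y)))%N.
  rewrite -(card_BH_nonzeros (form_p (x - y))); apply: eq_card => j; rewrite !inE !evE.
  by rewrite -subr_eq0 /mpoly_fun /= mevalB.
split=> //.
  rewrite /code_L -/ev limg_dim_eq ?dimvf //.
  apply/eqP; rewrite -subv0; apply/subvP=> p; rewrite memv_cap memv_ker memvf /= => /eqP evp.
  rewrite memv0; apply/eqP/val_inj/(mpoly_fun_eq0 (dhomog_is_dhomog p)); first lia.
  move=> v; apply/eqP; apply: contraTT few_zeros => pv.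
  rewrite -leqNgt; apply: leq_trans (zeros_le _ (form_p p) (ex_intro _ v pv)).
  rewrite leq_mul2l -(card_BH_zeros (form_p p)) /=; apply/subset_leq_card/subsetP => P PS.
  rewrite inE PS /=; apply/eqP; have := evE p (enum_rank_in PS P).
  by rewrite evp enum_rankK_in // mxE.
split=> [|x y].
  have [s [size_s uniq_s sq_s]] := exists_nzsq_seq lt_dq.
  (* d concurrent secants: a code word of minimum weight *)
  have [p0 homog_p0 p0E] := exists_product_form s; rewrite size_s in homog_p0.
  pose p := DHomog homog_p0; exists (ev p), (ev 0).
  have dist_p : hamming_dist (ev p) (ev 0) = (#|S| - d * (q + 3) %/ 2)%N.
    rewrite distE subr0 -[in RHS]size_s -(BH_nzeros_secants uniq_s sq_s) mulKn //; congr (_ - _)%N.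
    by apply: eq_nproj => v _; rewrite -p0E.
  split=> //; rewrite ?memv_img ?memvf //.
  apply: contraTneq few_zeros => evp0; move: dist_p; rewrite evp0 distE subrr.
  rewrite (_ : BH_nzeros _ = #|S|); first by rewrite subnn; lia.
  rewrite -(card_BH_zeros (form_p 0)); apply: eq_card => P.
  by rewrite inE /mpoly_fun /= meval0 eqxx andbT.
move=> /memv_imgP[p _ ->] /memv_imgP[p' _ ->] neq; rewrite distE leq_sub2l //.
rewrite leq_divRL // mulnC; apply: zeros_le => //.
have [j neq_j] : exists j, ev p 0 j != ev p' 0 j.
  apply/existsP; apply: contraNT neq => /existsPn eq_j.
  by apply/eqP/rowP => j; apply/eqP/negPn/eq_j.
exists (rep (enum_val j)); move: neq_j; rewrite !evE.
by rewrite -subr_eq0 /mpoly_fun /= mevalB.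
Qed.
End BHCode.

(** With q = 2 m + 1 the three terms are 2 m^2 + 2 m, m + 1 and 1. *)
Lemma achieves_griesmer_BH (q : nat) : odd q -> (1 < q)%N ->
  achieves_griesmer q ((q ^ 2 + q + 2) %/ 2) 3 ((q ^ 2 - 1) %/ 2).
Proof.
move=> odd_q q_gt1; pose m := q./2.
have qE : q = (2 * m).+1 by rewrite -[LHS]odd_double_half odd_q mul2n.
have m_gt0 : (0 < m)%N by lia.
have nE : ((q ^ 2 + q + 2) %/ 2 = 2 * m ^ 2 + 3 * m + 2)%N by nia.
have dE : ((q ^ 2 - 1) %/ 2 = 2 * m ^ 2 + 2 * m)%N by nia.
have ceilE (N D c : nat) : (0 < D)%N -> (D * c < N + D)%N -> (N <= D * c)%N ->
    Num.ceil (N%:Q / D%:R) = c%:Z.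
  move=> D_gt0 lt_N le_N; rewrite pmulrn; have D_gt0Q : 0 < D%:Q :> rat by rewrite ltr0n.
  apply: ceil_def; rewrite ler_pdivrMr // ltr_pdivlMr // -!intrM ltr_int ler_int.
  by apply/andP; split; nia.
rewrite /achieves_griesmer nE dE !big_ord_recr big_ord0 /= add0r.
rewrite -!natrX (ceilE _ (q ^ 0)%N (2 * m ^ 2 + 2 * m)%N) ?(ceilE _ (q ^ 1)%N m.+1)
  ?(ceilE _ (q ^ 2)%N 1%N) //; nia.
Qed.

Local Close Scope ring_scope.

Theorem proposition5p2 (q : nat) (F : finFieldType) (L : closedFieldType)
    (iota : {rmorphism F -> L}) (rep : {set 'rV[F]_3} -> 'rV[F]_3)
    (cardF : #|F| = q) (q_odd : odd q)
    (repP : forall P, P \in BH_points iota -> rep P \in P) :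
  [/\ is_code (code_L (BH_points iota) rep 1)
        ((q ^ 2 + q + 2) %/ 2) 3 ((q ^ 2 - 1) %/ 2)
      /\ achieves_griesmer q ((q ^ 2 + q + 2) %/ 2) 3 ((q ^ 2 - 1) %/ 2),
      5 <= q ->
      is_code (code_L (BH_points iota) rep 2)
        ((q ^ 2 + q + 2) %/ 2) 6 ((q ^ 2 - q - 4) %/ 2)
    & 7 <= q ->
      is_code (code_L (BH_points iota) rep 3)
        ((q ^ 2 + q + 2) %/ 2) 10 ((q ^ 2 - 2 * q - 7) %/ 2)].
Proof.
subst q; have q_gt1 := finNzRing_gt1 F.
have codeP d := @is_code_BH F L iota rep q_odd repP d.
have nE : ((#|F| ^ 2 + #|F| + 2) %/ 2 * 2 = #|F| ^ 2 + #|F| + 2)%N.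
  by rewrite -(card_BH iota q_odd) mulKn // mulnC.
split=> [|q_ge5|q_ge7]; first split.
- have := codeP 1%N isT; rewrite (_ : _ - _ = (#|F| ^ 2 - 1) %/ 2)%N; last by nia.
  by apply; move: q_odd q_gt1; case: #|F| => [|[|[|n]]].
- exact: achieves_griesmer_BH.
- have := codeP 2%N isT q_ge5; rewrite (_ : _ - _ = (#|F| ^ 2 - #|F| - 4) %/ 2)%N //; nia.
have := codeP 3%N isT q_ge7; rewrite (_ : _ - _ = (#|F| ^ 2 - 2 * #|F| - 7) %/ 2)%N //; nia.
Qed.
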